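(* (i) The fundamental group of the Klein bottle is (isomorphic to) a subgroup of every generalized Hantzsche-Wendt group of dimension $n\ge2$. (ii) The graph $\mathbf{G}$ is connected.
   Context: A Bieberbach group of dimension $n$ is a torsion-free, discrete, cocompact subgroup $\Gamma$ of $\mathrm{E}(n)=\mathrm{O}(n)\ltimes\mathbb{R}^n$, the group of rigid motions of $\mathbb{R}^n$. Its translation subgroup $\Lambda\cong\mathbb{Z}^n$ is normal of finite index, and $\Gamma/\Lambda$ is its holonomy group. The group $\Gamma$ is a generalized Hantzsche-Wendt (GHW) group if its holonomy group is isomorphic to $\mathbb{Z}_2^{\,n-1}$. The graph $\mathbf{G}$ is defined as follows: its vertices are the (isomorphism classes of) GHW groups of dimension $n\ge2$; a vertex has dimension $n$ if it corresponds to a GHW group of dimension $n$; edges are defined only between vertices of consecutive dimensions, and there is an edge between two such vertices exactly when one of the corresponding groups is isomorphic to a subgroup of the other, i.e. there is a monomorphism from one into the other. *)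

(* Defs.v *)
From HB Require Import structures.
From mathcomp Require Import all_boot all_order all_algebra ring lra.
From mathcomp Require Import generic_quotient.
From mathcomp Require Import all_classical all_reals all_analysis homotopy.

Set Implicit Arguments.
Unset Strict Implicit.
Unset Printing Implicit Defensive.

Import Order.TTheory GRing.Theory Num.Theory.
Import numFieldNormedType.Exports.

Local Open Scope classical_set_scope.
Local Open Scope ring_scope.
Local Open Scope quotient_scope.

Definition monomorphic (G H : groupType) : Prop :=
  exists f : {multiplicative G -> H}, injective f.

Definition isomorphic (G H : groupType) : Prop :=
  exists f : {multiplicative G -> H}, bijective f.

(* A groupClosed has values in bool; under the classical axioms of
   MathComp-Analysis this still covers every subgroup. *)
Section Subgroup.
Local Open Scope group_scope.
Variables (G : groupType) (H : groupClosed G).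

Record subgroup := Subgroup { subgroup_val : G; _ : subgroup_val \in H }.

HB.instance Definition _ := [isSub for subgroup_val].
HB.instance Definition _ := [Choice of subgroup by <:].

Fact subgroup_closed : group_closed [pred x | x \in H].
Proof. by split; [exact: gpred1 | exact: gpredF]. Qed.

HB.instance Definition _ :=
  SubChoice_isSubGroup.Build G [pred x | x \in H] subgroup subgroup_closed.

End Subgroup.

Section PredGroup.
Variables (G : groupType) (S : {pred G}).

Definition pred_group of group_closed S : {pred G} := S.

Variable S_closed : group_closed S.
Local Notation T := (pred_group S_closed).

HB.instance Definition _ :=
  isMulClosed.Build G T (group_closedM S_closed).
HB.instance Definition _ := isMul1Closed.Build G T (fst S_closed).
HB.instance Definition _ :=
  isInvClosed.Build G T (group_closedV S_closed).

End PredGroup.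

Section Cosets.
Local Open Scope group_scope.
Variables (G : groupType) (H : groupClosed G).

Definition coset_rel : rel G := [rel x y | x^-1 * y \in H].

Fact coset_rel_refl : reflexive coset_rel.
Proof. by move=> x; rewrite /coset_rel /= mulVg gpred1. Qed.

Fact coset_rel_sym : symmetric coset_rel.
Proof. by move=> x y; rewrite /coset_rel /= -gpredV invgM invgK. Qed.

Fact coset_rel_trans : transitive coset_rel.
Proof.
move=> y x z; rewrite /coset_rel /= => xy yz.
by rewrite -(mulVKg y z) mulgA gpredM.
Qed.

Canonical coset_equiv :=
  EquivRel coset_rel coset_rel_refl coset_rel_sym coset_rel_trans.

Definition coset_space := {eq_quot coset_equiv}.

HB.instance Definition _ := Choice.on coset_space.
HB.instance Definition _ := EqQuotient.on coset_space.

Definition normal_subgroup : Prop :=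
  forall x y : G, x \in H -> x ^ y \in H.

End Cosets.

Section QuotientGroup.
Local Open Scope group_scope.
Variables (G : groupType) (N : groupClosed G) (nN : normal_subgroup N).

Definition quotient_group of normal_subgroup N : Type := coset_space N.
Local Notation Q := (quotient_group nN).

HB.instance Definition _ := Choice.copy Q (coset_space N).

Local Notation pi := (\pi_(coset_space N)).

Definition qmul (x y : Q) : Q := pi (repr x * repr y).
Definition qone : Q := pi 1.
Definition qinv (x : Q) : Q := pi (repr x)^-1.

Fact pi_eqP (x y : G) : reflect (pi x = pi y) (x^-1 * y \in N).
Proof. exact: eqmodP. Qed.

Fact qmulE x y : qmul (pi x) (pi y) = pi (x * y).
Proof.
rewrite /qmul; apply/pi_eqP.
have /pi_eqP hx : pi (repr (pi x)) = pi x by rewrite reprK.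
have /pi_eqP hy : pi (repr (pi y)) = pi y by rewrite reprK.
move: (repr (pi x)) (repr (pi y)) hx hy => a b hx hy.
have -> : (a * b)^-1 * (x * y) = (a^-1 * x) ^ b * (b^-1 * y).
  by rewrite /conjg invgM -!mulgA mulVKg.
by rewrite gpredM// nN.
Qed.

Fact qinvE x : qinv (pi x) = pi x^-1.
Proof.
rewrite /qinv; apply/pi_eqP.
have /pi_eqP hx : pi x = pi (repr (pi x)) by rewrite reprK.
move: (repr (pi x)) hx => a hx; rewrite invgK.
have -> : a * x^-1 = (x^-1 * a) ^ (x^-1).
  by rewrite /conjg invgK !mulgA mulgV mul1g.
exact: nN.
Qed.

Fact qmulA : associative qmul.
Proof.
move=> x y z; rewrite -[x]reprK -[y]reprK -[z]reprK.
by rewrite (qmulE (repr y)) (qmulE (repr x) (repr y)) !qmulE mulgA.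
Qed.

Fact qmul1 : left_id qone qmul.
Proof. by move=> x; rewrite -[x]reprK qmulE mul1g. Qed.

Fact qmulr1 : right_id qone qmul.
Proof. by move=> x; rewrite -[x]reprK qmulE mulg1. Qed.

Fact qmulV : left_inverse qone qinv qmul.
Proof. by move=> x; rewrite -[x]reprK qinvE qmulE mulVg. Qed.

Fact qmulrV : right_inverse qone qinv qmul.
Proof. by move=> x; rewrite -[x]reprK qinvE qmulE mulgV. Qed.

HB.instance Definition _ := isGroup.Build Q qmulA qmul1 qmulr1 qmulV qmulrV.

End QuotientGroup.

Section Rigid.
Variables (R : realType) (n : nat).

(* The motion x |-> A x + a of R^n, with A orthogonal. *)
Record rigid := Rigid {
  linear_part : 'M[R]_n;
  translation_part : 'cV[R]_n;
  linear_part_orthogonal : linear_part^T *m linear_part == 1%:M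
}.

Definition rigid_pair (g : rigid) : 'M[R]_n * 'cV[R]_n :=
  (linear_part g, translation_part g).

Fact rigid_pair_inj : injective rigid_pair.
Proof.
by case=> [A a hA] [B b hB] [AB ab]; subst; rewrite (bool_irrelevance hA hB).
Qed.

HB.instance Definition _ := gen_eqMixin rigid.
HB.instance Definition _ := gen_choiceMixin rigid.

(* E(n) has the topology induced by the inclusion in 'M_n x R^n. *)
HB.instance Definition _ :=
  Topological.copy rigid (initial_topology rigid_pair).

Fact rigid_mul_subproof (g h : rigid) :
  (linear_part g *m linear_part h)^T *m (linear_part g *m linear_part h)
    == 1%:M.
Proof.
rewrite trmx_mul -mulmxA (mulmxA (linear_part g)^T).
rewrite (eqP (linear_part_orthogonal g)) mul1mx.
exact: linear_part_orthogonal.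
Qed.

Definition rigid_mul g h :=
  Rigid (linear_part g *m translation_part h + translation_part g)
    (rigid_mul_subproof g h).

Fact rigid_one_subproof : (1%:M : 'M[R]_n)^T *m 1%:M == 1%:M.
Proof. by rewrite trmx1 mulmx1. Qed.

Definition rigid_one := Rigid 0 rigid_one_subproof.

Fact rigid_linear_trmx (g : rigid) : linear_part g *m (linear_part g)^T = 1%:M.
Proof. exact/mulmx1C/eqP/linear_part_orthogonal. Qed.

Fact rigid_inv_subproof (g : rigid) :
  (linear_part g)^T^T *m (linear_part g)^T == 1%:M.
Proof. by rewrite trmxK rigid_linear_trmx. Qed.

Definition rigid_inv g :=
  Rigid (- ((linear_part g)^T *m translation_part g)) (rigid_inv_subproof g).

Fact rigid_mulA : associative rigid_mul.
Proof.
move=> g h k; apply: rigid_pair_inj; rewrite /rigid_pair /=.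
by rewrite mulmxDr !mulmxA addrA.
Qed.

Fact rigid_mul1 : left_id rigid_one rigid_mul.
Proof.
by move=> g; apply: rigid_pair_inj; rewrite /rigid_pair /= !mul1mx addr0.
Qed.

Fact rigid_mulr1 : right_id rigid_one rigid_mul.
Proof.
by move=> g; apply: rigid_pair_inj; rewrite /rigid_pair /= mulmx1 mulmx0 add0r.
Qed.

Fact rigid_mulV : left_inverse rigid_one rigid_inv rigid_mul.
Proof.
move=> g; apply: rigid_pair_inj; rewrite /rigid_pair /=.
by rewrite (eqP (linear_part_orthogonal g)) subrr.
Qed.

Fact rigid_mulrV : right_inverse rigid_one rigid_inv rigid_mul.
Proof.
move=> g; apply: rigid_pair_inj; rewrite /rigid_pair /=.
by rewrite rigid_linear_trmx mulmxN mulmxA rigid_linear_trmx mul1mx addNr.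
Qed.

HB.instance Definition _ := isGroup.Build rigid
  rigid_mulA rigid_mul1 rigid_mulr1 rigid_mulV rigid_mulrV.

End Rigid.

Section Bieberbach.
Variables (R : realType) (n : nat) (Gamma : groupClosed (rigid R n)).

Definition torsion_free : Prop := forall (g : rigid R n) (k : nat),
  g \in Gamma -> (0 < k)%N -> (g ^+ k = 1)%g -> g = 1%g.

Definition discrete : Prop := forall g, g \in Gamma -> isolated [set` Gamma] g.

Definition cocompact : Prop :=
  compact [set: quotient_topology (coset_space Gamma)].

Definition Bieberbach : Prop := [/\ torsion_free, discrete & cocompact].

Definition translations : {pred subgroup Gamma} :=
  [pred x | linear_part (\val x) == 1%:M].

Fact translations_closed : group_closed translations.
Proof.
split=> [|x y]; rewrite !inE /= ?eqxx// => /eqP x1 /eqP y1.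
by rewrite x1 y1 trmx1 mulmx1.
Qed.

HB.instance Definition _ :=
  isMulClosed.Build _ translations (group_closedM translations_closed).
HB.instance Definition _ :=
  isMul1Closed.Build _ translations (fst translations_closed).
HB.instance Definition _ :=
  isInvClosed.Build _ translations (group_closedV translations_closed).

Fact translations_normal : normal_subgroup translations.
Proof.
move=> x y; rewrite !inE /= => /eqP x1.
by rewrite x1 mul1mx (eqP (linear_part_orthogonal _)).
Qed.

Definition holonomy := quotient_group translations_normal.

(* The group Z_2^(n-1) is written additively. *)
Definition GHW : Prop := Bieberbach /\
  exists2 f : holonomy -> 'rV['Z_2]_n.-1,
    {morph f : x y / (x * y)%g >-> x + y} & bijective f.

End Bieberbach.

Section UnitInterval.
Variable R : realType.

Definition unit_interval : Type := set_type (`[0, 1]%classic : set R).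
Local Notation I := unit_interval.

HB.instance Definition _ := Topological.on I.

Definition clamp (t : R) : R := Num.max 0 (Num.min 1 t).

Fact clamp_subproof t : clamp t \in (`[0, 1]%classic : set R).
Proof.
by rewrite inE /= in_itv /= /clamp le_max lexx ge_max ler01 ge_min lexx.
Qed.

Definition iclamp (t : R) : I := SigSub (clamp_subproof t).

Fact iclampE (t : R) : \val (iclamp t) = clamp t.
Proof. by []. Qed.

Fact itv_ge0 (t : I) : 0 <= \val t.
Proof. by case: t => t /= /set_mem /=; rewrite in_itv /= => /andP[]. Qed.

Fact itv_le1 (t : I) : \val t <= 1.
Proof. by case: t => t /= /set_mem /=; rewrite in_itv /= => /andP[]. Qed.

Fact clamp_id t : 0 <= t <= 1 -> clamp t = t.
Proof. by case/andP=> t0 t1; rewrite /clamp min_r// max_r. Qed.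

Fact clamp_le0 t : t <= 0 -> clamp t = 0.
Proof.
by move=> t0; rewrite /clamp min_r ?max_l//; apply: le_trans t0 ler01.
Qed.

Fact clamp_ge1 t : 1 <= t -> clamp t = 1.
Proof. by move=> t1; rewrite /clamp min_l// max_r. Qed.

Fact iclampK (t : I) : iclamp (\val t) = t.
Proof. by apply: val_inj; rewrite /= clamp_id// itv_ge0 itv_le1. Qed.

Fact iclamp_neq : iclamp 0 != iclamp 1.
Proof.
apply/eqP => /(congr1 val) /=; rewrite !clamp_id ?lexx ?ler01// => /eqP.
by rewrite eq_sym oner_eq0.
Qed.

HB.instance Definition _ := isBiPointed.Build I iclamp_neq.

Fact ival_zero : \val (zero : I) = 0.
Proof. by rewrite /= clamp_id// lexx ler01. Qed.

Fact ival_one : \val (one : I) = 1.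
Proof. by rewrite /= clamp_id// lexx ler01. Qed.

Fact continuous_ival : continuous (val : I -> R).
Proof. exact: initial_continuous. Qed.

Fact continuous_clamp : continuous clamp.
Proof.
move=> t; apply: (@continuous_max R R (fun=> 0) (fun t => Num.min 1 t)).
  exact: cvg_cst.
by apply: (@continuous_min R R (fun=> 1) id); [exact: cvg_cst | exact: cvg_id].
Qed.

Fact continuous_iclamp : continuous iclamp.
Proof.
apply/continuousP => _ [B oB <-]; rewrite -comp_preimage.
by move/continuousP: continuous_clamp; apply.
Qed.

End UnitInterval.

Section Pasting.
Variables (R : realType) (T X : topologicalType).

Fact paste_continuous (h : T -> R) (f g : T -> X) :
  continuous h -> continuous f -> continuous g ->
  (forall t, h t = 0 -> f t = g t) ->
  continuous (fun t => if h t <= 0 then f t else g t).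
Proof.
move=> ch cf cg fg.
apply/continuous_subspace_setT.
have -> : [set: T] = [set t | h t <= 0] `|` [set t | 0 <= h t].
  by apply/seteqP; split=> t //= _; apply/orP; exact: le_total.
apply: withinU_continuous.
- by apply: (@preimage_closed _ _ h [set x | x <= 0]) => //; exact: closed_le.
- by apply: (@preimage_closed _ _ h [set x | 0 <= x]) => //; exact: closed_ge.
- apply: (@subspace_eq_continuous _ _ _ f); last exact: continuous_subspaceT.
  by move=> t /set_mem /= h0; rewrite /from_subspace h0.
- apply: (@subspace_eq_continuous _ _ _ g); last exact: continuous_subspaceT.
  move=> t /set_mem /= h0; rewrite /from_subspace; case: ifP => // h0'.
  by rewrite fg//; apply/eqP; rewrite eq_le h0 h0'.
Qed.

End Pasting.

Section Homotopy.
Variables (R : realType) (X : topologicalType).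
Local Notation I := (unit_interval R).

(* Homotopies fix the end points. *)
Definition homotopic (x y : X) (p q : {path I from x to y}) : Prop :=
  exists H : I * I -> X, [/\ continuous H,
    forall t, H (t, zero) = p t, forall t, H (t, one) = q t,
    forall s, H (zero, s) = x & forall s, H (one, s) = y].

Fact continuous_ipath (x y : X) (p : {path I from x to y})
    (T : topologicalType) (u : T -> R) :
  continuous u -> continuous (fun t => p (iclamp (u t))).
Proof.
move=> cu t; apply: (@continuous_comp _ _ _ (fun t => iclamp (u t)) p).
  by apply: continuous_comp; [exact: cu | exact: continuous_iclamp].
exact: cts_fun.
Qed.

Fact continuous_ival1 : continuous (fun z : I * I => \val z.1).
Proof.
by move=> z; apply: continuous_comp; [exact: cvg_fst | exact: continuous_ival].
Qed.

Fact continuous_ival2 : continuous (fun z : I * I => \val z.2).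
Proof.
by move=> z; apply: continuous_comp; [exact: cvg_snd | exact: continuous_ival].
Qed.

Fact continuous_pair (T U V : topologicalType) (f : T -> U) (g : T -> V) :
  continuous f -> continuous g -> continuous (fun t => (f t, g t)).
Proof. by move=> cf cg t; exact: (cvg_pair (cf t) (cg t)). Qed.

Fact continuous_affine (T : topologicalType) (a b : R) (u : T -> R) :
  continuous u -> continuous (fun t => a * u t + b).
Proof.
move=> cu t; apply: cvgD; last exact: cvg_cst.
by apply: cvgM; [exact: cvg_cst | exact: cu].
Qed.

Fact continuous_subr (T : topologicalType) (b : R) (u : T -> R) :
  continuous u -> continuous (fun t => u t - b).
Proof. by move=> cu t; apply: cvgB; [exact: cu | exact: cvg_cst]. Qed.

Fact continuous_rsub (T : topologicalType) (b : R) (u : T -> R) :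
  continuous u -> continuous (fun t => b - u t).
Proof. by move=> cu t; apply: cvgB; [exact: cvg_cst | exact: cu]. Qed.

Fact homotopic_reparam (x y a b : X) (p : {path I from x to y})
    (q r : {path I from a to b}) (u v : R -> R) :
  continuous u -> continuous v ->
  clamp (u 0) = clamp (v 0) -> clamp (u 1) = clamp (v 1) ->
  (forall t, q t = p (iclamp (u (\val t)))) ->
  (forall t, r t = p (iclamp (v (\val t)))) -> homotopic q r.
Proof.
move=> cu cv uv0 uv1 qE rE.
pose w (t s : R) : R := (1 - s) * clamp (u t) + s * clamp (v t).
have cw : continuous (fun z : I * I => w (\val z.1) (\val z.2)).
  move=> z; apply: cvgD; apply: cvgM.
  - by apply: cvgB; [exact: cvg_cst | exact: continuous_ival2].
  - apply: continuous_comp; last exact: continuous_clamp.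
    by apply: continuous_comp; [exact: continuous_ival1 | exact: cu].
  - exact: continuous_ival2.
  - apply: continuous_comp; last exact: continuous_clamp.
    by apply: continuous_comp; [exact: continuous_ival1 | exact: cv].
have clampK t : iclamp (clamp t) = iclamp t.
  exact: (iclampK (iclamp t)).
have w0 t : w t 0 = clamp (u t) by rewrite /w subr0 mul1r mul0r addr0.
have w1 t : w t 1 = clamp (v t) by rewrite /w subrr mul1r mul0r add0r.
exists (fun z => p (iclamp (w (\val z.1) (\val z.2)))).
split=> [|t|t|s|s]; first exact: continuous_ipath; cbv beta.
- by rewrite [(_, _).1]/fst [(_, _).2]/snd ival_zero w0 clampK qE.
- by rewrite [(_, _).1]/fst [(_, _).2]/snd ival_one w1 clampK rE.
- rewrite [(_, _).1]/fst [(_, _).2]/snd ival_zero /w -uv0 -mulrDl subrK mul1r.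
  by rewrite clampK -[in RHS](@path_zero _ _ _ _ q) qE ival_zero.
- rewrite [(_, _).1]/fst [(_, _).2]/snd ival_one /w -uv1 -mulrDl subrK mul1r.
  by rewrite clampK -[in RHS](@path_one _ _ _ _ q) qE ival_one.
Qed.

Fact homotopic_refl (x y : X) (p : {path I from x to y}) : homotopic p p.
Proof.
have cid : continuous (@id R) by move=> t; exact: cvg_id.
by apply: (homotopic_reparam (p := p) cid cid) => // t; rewrite /id iclampK.
Qed.

Fact homotopic_sym (x y : X) (p q : {path I from x to y}) :
  homotopic p q -> homotopic q p.
Proof.
case=> H [cH H0 H1 Hx Hy].
exists (fun z => H (z.1, iclamp (1 - \val z.2))); split=> [|t|t|s|s]; cbv beta;
  rewrite ?[(_, _).1]/fst ?[(_, _).2]/snd //.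
- move=> z; apply: (@continuous_comp _ _ _ (fun z : I * I =>
    (z.1, iclamp (1 - \val z.2))) H); last exact: cH.
  move: z; apply: continuous_pair => z; first exact: cvg_fst.
  apply: continuous_comp; last exact: continuous_iclamp.
  by apply: cvgB; [exact: cvg_cst | exact: continuous_ival2].
- by rewrite -H1 ival_zero subr0.
- by rewrite -H0 ival_one subrr.
Qed.

Fact homotopic_trans (x y : X) (q p r : {path I from x to y}) :
  homotopic p q -> homotopic q r -> homotopic p r.
Proof.
case=> H [cH H0 H1 Hx Hy] [K [cK K0 K1 Kx Ky]].
exists (fun z => if \val z.2 - 2^-1 <= 0 then H (z.1, iclamp (2 * \val z.2))
  else K (z.1, iclamp (2 * \val z.2 - 1))); split.
- have c2 : continuous (fun z : I * I => 2 * \val z.2).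
    by move=> z; apply: cvgM; [exact: cvg_cst | exact: continuous_ival2].
  apply: paste_continuous.
  + by move=> z; apply: cvgB; [exact: continuous_ival2 | exact: cvg_cst].
  + move=> z; apply: (@continuous_comp _ _ _ (fun z : I * I =>
      (z.1, iclamp (2 * \val z.2))) H); last exact: cH.
    move: z; apply: continuous_pair => z; first exact: cvg_fst.
    by apply: continuous_comp; [exact: c2 | exact: continuous_iclamp].
  + move=> z; apply: (@continuous_comp _ _ _ (fun z : I * I =>
      (z.1, iclamp (2 * \val z.2 - 1))) K); last exact: cK.
    move: z; apply: continuous_pair => z; first exact: cvg_fst.
    apply: continuous_comp; last exact: continuous_iclamp.
    by apply: cvgB; [exact: c2 | exact: cvg_cst].
  + move=> z /eqP; rewrite subr_eq0 => /eqP ->.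
    by rewrite mulfV// subrr H1 K0.
- by move=> t; rewrite ival_zero sub0r oppr_le0 invr_ge0 ler0n mulr0 H0.
- move=> t; rewrite ival_one ifF; last by apply/negbTE; rewrite -ltNge; lra.
  by rewrite mulr1 -addrA subrr addr0 K1.
- by move=> s; rewrite Hx Kx if_same.
- by move=> s; rewrite Hy Ky if_same.
Qed.

Section Concatenation.
Variables (x y z : X) (p : {path I from x to y}) (q : {path I from y to z}).

Definition concat_fun (t : I) : X :=
  if \val t - 2^-1 <= 0 then p (iclamp (2 * \val t))
  else q (iclamp (2 * \val t - 1)).

Fact continuous_concat : continuous concat_fun.
Proof.
have c2 : continuous (fun t : I => 2 * \val t).
  have := @continuous_affine I 2 0 _ (@continuous_ival R).
  by under eq_fun do rewrite addr0.
apply: paste_continuous.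
- exact/continuous_subr/continuous_ival.
- exact: continuous_ipath.
- exact/continuous_ipath/continuous_subr.
- move=> t /eqP; rewrite subr_eq0 => /eqP ->.
  by rewrite mulfV// subrr (@path_one _ _ _ _ p) (@path_zero _ _ _ _ q).
Qed.

Fact concat_zero : concat_fun zero = x.
Proof.
rewrite /concat_fun ival_zero sub0r oppr_le0 invr_ge0 ler0n mulr0.
by rewrite (@path_zero _ _ _ _ p).
Qed.

Fact concat_one : concat_fun one = z.
Proof.
rewrite /concat_fun ival_one ifF; last by apply/negbTE; rewrite -ltNge; lra.
by rewrite mulr1 -addrA subrr addr0 (@path_one _ _ _ _ q).
Qed.

Definition concat : {path I from x to z} :=
  mk_path continuous_concat concat_zero concat_one.

End Concatenation.

Section Reverse.
Variables (x y : X) (p : {path I from x to y}).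

Definition reverse_fun (t : I) : X := p (iclamp (1 - \val t)).

Fact continuous_reverse : continuous reverse_fun.
Proof.
exact/continuous_ipath/continuous_rsub/continuous_ival.
Qed.

Fact reverse_zero : reverse_fun zero = y.
Proof. by rewrite /reverse_fun ival_zero subr0 (@path_one _ _ _ _ p). Qed.

Fact reverse_one : reverse_fun one = x.
Proof. by rewrite /reverse_fun ival_one subrr (@path_zero _ _ _ _ p). Qed.

Definition reverse : {path I from y to x} :=
  mk_path continuous_reverse reverse_zero reverse_one.

End Reverse.

End Homotopy.

Section FundamentalGroup.
Variables (R : realType) (X : topologicalType).
Local Notation I := (unit_interval R).

Fact concatE (x y z : X) (p : {path I from x to y}) (q : {path I from y to z})
    (t : I) :
  concat p q t = if \val t <= 2^-1 then p (iclamp (2 * \val t))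
                 else q (iclamp (2 * \val t - 1)).
Proof. by rewrite -subr_le0. Qed.

Fact homotopic_concat (x y z : X) (p p' : {path I from x to y})
    (q q' : {path I from y to z}) :
  homotopic p p' -> homotopic q q' -> homotopic (concat p q) (concat p' q').
Proof.
case=> H [cH H0 H1 Hx Hy] [K [cK K0 K1 Kx Ky]].
exists (fun z => if \val z.1 - 2^-1 <= 0 then H (iclamp (2 * \val z.1), z.2)
  else K (iclamp (2 * \val z.1 - 1), z.2)).
split=> [|t|t|s|s]; cbv beta; rewrite ?[(_, _).1]/fst ?[(_, _).2]/snd.
- have c2 : continuous (fun z : I * I => 2 * \val z.1).
    have := @continuous_affine R _ 2 0 _ (@continuous_ival1 R).
    by under eq_fun do rewrite addr0.
  apply: paste_continuous.
  + exact/continuous_subr/continuous_ival1.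
  + move=> u; apply: (@continuous_comp _ _ _ (fun u : I * I =>
      (iclamp (2 * \val u.1), u.2)) H); last exact: cH.
    move: u; apply: continuous_pair => u; last exact: cvg_snd.
    by apply: continuous_comp; [exact: c2 | exact: continuous_iclamp].
  + move=> u; apply: (@continuous_comp _ _ _ (fun u : I * I =>
      (iclamp (2 * \val u.1 - 1), u.2)) K); last exact: cK.
    move: u; apply: continuous_pair => u; last exact: cvg_snd.
    apply: continuous_comp; last exact: continuous_iclamp.
    exact: (continuous_subr c2).
  + move=> u /eqP; rewrite subr_eq0 => /eqP ->.
    by rewrite mulfV// subrr (Hy u.2) (Kx u.2).
- by rewrite concatE subr_le0 H0 K0.
- by rewrite concatE subr_le0 H1 K1.
- by rewrite ival_zero sub0r oppr_le0 invr_ge0 ler0n mulr0 (Hx s).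
- rewrite ival_one ifF; last by apply/negbTE; rewrite -ltNge; lra.
  by rewrite mulr1 -addrA subrr addr0 (Ky s).
Qed.

Fact homotopic_reverse (x y : X) (p q : {path I from x to y}) :
  homotopic p q -> homotopic (reverse p) (reverse q).
Proof.
case=> H [cH H0 H1 Hx Hy].
exists (fun z => H (iclamp (1 - \val z.1), z.2)).
split=> [|t|t|s|s]; cbv beta; rewrite ?[(_, _).1]/fst ?[(_, _).2]/snd.
- move=> u; apply: (@continuous_comp _ _ _ (fun u : I * I =>
    (iclamp (1 - \val u.1), u.2)) H); last exact: cH.
  move: u; apply: continuous_pair => u; last exact: cvg_snd.
  apply: continuous_comp; last exact: continuous_iclamp.
  exact: (continuous_rsub (@continuous_ival1 R)).
- exact: H0.
- exact: H1.
- by rewrite ival_zero subr0 (Hy s).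
- by rewrite ival_one subrr (Hx s).
Qed.

Fact continuous_id : continuous (@id R).
Proof. by move=> t; exact: cvg_id. Qed.

Fact continuous_minR (u v : R -> R) :
  continuous u -> continuous v -> continuous (fun t => Num.min (u t) (v t)).
Proof.
by move=> cu cv t; apply: (@continuous_min R R u v); [exact: cu | exact: cv].
Qed.

Fact continuous_aff (a b : R) : continuous (fun t => a * t + b).
Proof. exact/continuous_affine/continuous_id. Qed.

Fact concatA (x y z w : X) (p : {path I from x to y})
    (q : {path I from y to z}) (r : {path I from z to w}) :
  homotopic (concat (concat p q) r) (concat p (concat q r)).
Proof.
pose u (a : R) := Num.min (2 * a + 0)
  (Num.min (1 * a + 4^-1) (2^-1 * a + 2^-1)).
have cu : continuous u.
  by do 2?[apply: continuous_minR]; exact: continuous_aff.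
apply: (homotopic_reparam (p := concat p (concat q r)) cu continuous_id).
- by rewrite /u /id min_l ?mulr0 ?addr0// le_min; apply/andP; split; lra.
- congr clamp; rewrite /u /id [Num.min (_ + 4^-1) _]min_r; last lra.
  by rewrite min_r; lra.
- move=> t; have := itv_ge0 t; have := itv_le1 t.
  rewrite !concatE !iclampE; move: (\val t) => a a1 a0.
  have [a4|a4] := leP a 4^-1; last have [a2|a2] := leP a 2^-1.
  + have -> : u a = 2 * a.
      by rewrite /u min_l ?addr0// le_min; apply/andP; split; lra.
    rewrite !(@clamp_id _ (2 * a)); try (apply/andP; split; lra).
    by rewrite !ifT//; lra.
  + have -> : u a = a + 4^-1.
      rewrite /u [Num.min (_ + 4^-1) _]min_l; last lra.
      by rewrite min_r ?mul1r//; lra.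
    rewrite (@clamp_id _ (2 * a)); last by (apply/andP; split; lra).
    rewrite (@clamp_id _ (a + 4^-1)); last by (apply/andP; split; lra).
    rewrite (@clamp_id _ (2 * (a + 4^-1) - 1)); last first.
      by apply/andP; split; lra.
    rewrite ifF; last by apply/negbTE; rewrite -ltNge; lra.
    rewrite ifF; last by apply/negbTE; rewrite -ltNge; lra.
    rewrite ifT; last lra.
    by congr (q (iclamp _)); lra.
  + have -> : u a = 2^-1 * a + 2^-1.
      rewrite /u [Num.min (_ + 4^-1) _]min_r; last lra.
      by rewrite min_r//; lra.
    rewrite (@clamp_id _ (2^-1 * a + 2^-1)); last by (apply/andP; split; lra).
    rewrite (@clamp_id _ (2 * (2^-1 * a + 2^-1) - 1)); last first.
      by apply/andP; split; lra.
    rewrite ifF; last by apply/negbTE; rewrite -ltNge; lra.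
    rewrite ifF; last by apply/negbTE; rewrite -ltNge; lra.
    by congr (r (iclamp _)); lra.
- by move=> t; rewrite /id iclampK.
Qed.

Fact concat1p (x y : X) (p : {path I from x to y}) :
  homotopic (concat (cst x) p) p.
Proof.
apply: (homotopic_reparam (p := p) (@continuous_aff 2 (- 1)) continuous_id).
- by rewrite /id mulr0 add0r clamp_le0 ?clamp_id ?lexx ?ler01// oppr_le0.
- by congr clamp; rewrite /id; lra.
- move=> t; rewrite concatE; case: ifP => // t2.
  have -> : iclamp (2 * \val t - 1) = zero.
    by apply: val_inj; rewrite iclampE ival_zero clamp_le0//; lra.
  by rewrite (@path_zero _ _ _ _ p).
- by move=> t; rewrite /id iclampK.
Qed.

Fact concatp1 (x y : X) (p : {path I from x to y}) :
  homotopic (concat p (cst y)) p.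
Proof.
apply: (homotopic_reparam (p := p) (@continuous_aff 2 0) continuous_id).
- by rewrite /id mulr0 add0r.
- by rewrite /id addr0 mulr1 !clamp_ge1//; lra.
- move=> t; rewrite concatE addr0; case: ifP => // /negbT; rewrite -ltNge => t2.
  have -> : iclamp (2 * \val t) = one.
    by apply: val_inj; rewrite iclampE ival_one clamp_ge1//; lra.
  by rewrite (@path_one _ _ _ _ p).
- by move=> t; rewrite /id iclampK.
Qed.

Fact concatpV (x y : X) (p : {path I from x to y}) :
  homotopic (concat p (reverse p)) (cst x).
Proof.
pose u (a : R) := Num.min (2 * a + 0) ((- 2) * a + 2).
have cu : continuous u by apply: continuous_minR; exact: continuous_aff.
apply: (homotopic_reparam (p := p) cu (@cst_continuous _ _ 0)).
- by rewrite /u mulr0 addr0 mulr0 add0r min_l.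
- by congr clamp; rewrite /u [Num.min _ _]min_r; lra.
- move=> t; rewrite concatE; have := itv_ge0 t; have := itv_le1 t.
  move: (\val t) => a a1 a0.
  case: ifP => [a2|/negbT]; last rewrite -ltNge => a2.
    by rewrite /u min_l ?addr0//; lra.
  rewrite [LHS](_ : _ = p (iclamp (1 - clamp (2 * a - 1))))//.
  rewrite clamp_id; last by apply/andP; split; lra.
  by congr (p (iclamp _)); rewrite /u min_r; lra.
- by move=> t; rewrite -[LHS](@path_zero _ _ _ _ p).
Qed.

Fact reverseK (x y : X) (p : {path I from x to y}) :
  homotopic (reverse (reverse p)) p.
Proof.
apply: (homotopic_reparam (p := p) continuous_id continuous_id) => // t.
  have := itv_ge0 t; have := itv_le1 t => t1 t0.
  rewrite [LHS](_ : _ = p (iclamp (1 - clamp (1 - \val t))))//.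
  rewrite clamp_id; last by apply/andP; split; lra.
  by congr (p (iclamp _)); rewrite /id; lra.
by rewrite /id iclampK.
Qed.

Fact concatVp (x y : X) (p : {path I from x to y}) :
  homotopic (concat (reverse p) p) (cst y).
Proof.
apply: homotopic_trans (concatpV (reverse p)).
apply: homotopic_concat; first exact: homotopic_refl.
exact/homotopic_sym/reverseK.
Qed.

Variable x : X.
Local Notation loop := {path I from x to x}.

Definition homotopy_rel : rel loop := [rel p q | `[< homotopic p q >]].

Fact homotopy_rel_refl : reflexive homotopy_rel.
Proof. by move=> p; apply/asboolP; exact: homotopic_refl. Qed.

Fact homotopy_rel_sym : symmetric homotopy_rel.
Proof.
by move=> p q; apply/asboolP/asboolP; exact: homotopic_sym.
Qed.

Fact homotopy_rel_trans : transitive homotopy_rel.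
Proof.
move=> q p r /asboolP pq /asboolP qr; apply/asboolP.
exact: homotopic_trans pq qr.
Qed.

Canonical homotopy_equiv :=
  EquivRel homotopy_rel homotopy_rel_refl homotopy_rel_sym homotopy_rel_trans.

Definition fundamental_group := {eq_quot homotopy_equiv}.

HB.instance Definition _ := Choice.on fundamental_group.
HB.instance Definition _ := EqQuotient.on fundamental_group.

Local Notation pi := (\pi_fundamental_group).

Definition pi1_mul (a b : fundamental_group) : fundamental_group :=
  pi (concat (repr a) (repr b)).
Definition pi1_one : fundamental_group := pi (cst x).
Definition pi1_inv (a : fundamental_group) : fundamental_group :=
  pi (reverse (repr a)).

Fact pi1_eqP (p q : loop) : homotopic p q <-> pi p = pi q.
Proof.
by split=> [pq|/eqmodP/asboolP//]; apply/eqmodP/asboolP.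
Qed.

Fact pi1_repr (p : loop) : homotopic (repr (pi p)) p.
Proof. by apply/pi1_eqP; rewrite reprK. Qed.

Fact pi1_mulE p q : pi1_mul (pi p) (pi q) = pi (concat p q).
Proof. by apply/pi1_eqP/homotopic_concat; exact: pi1_repr. Qed.

Fact pi1_invE p : pi1_inv (pi p) = pi (reverse p).
Proof. by apply/pi1_eqP/homotopic_reverse/pi1_repr. Qed.

Fact pi1_mulA : associative pi1_mul.
Proof.
move=> a b c; rewrite -[a]reprK -[b]reprK -[c]reprK.
rewrite (pi1_mulE (repr b)) (pi1_mulE (repr a) (repr b)).
rewrite (pi1_mulE (repr a)) (pi1_mulE (concat _ _)).
exact/esym/pi1_eqP/concatA.
Qed.

Fact pi1_mul1 : left_id pi1_one pi1_mul.
Proof.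
by move=> a; rewrite -[a]reprK pi1_mulE; exact/pi1_eqP/concat1p.
Qed.

Fact pi1_mulr1 : right_id pi1_one pi1_mul.
Proof.
by move=> a; rewrite -[a]reprK pi1_mulE; exact/pi1_eqP/concatp1.
Qed.

Fact pi1_mulV : left_inverse pi1_one pi1_inv pi1_mul.
Proof.
move=> a; rewrite -[a]reprK pi1_invE pi1_mulE.
exact/pi1_eqP/concatVp.
Qed.

Fact pi1_mulrV : right_inverse pi1_one pi1_inv pi1_mul.
Proof.
move=> a; rewrite -[a]reprK pi1_invE pi1_mulE.
exact/pi1_eqP/concatpV.
Qed.

HB.instance Definition _ := isGroup.Build fundamental_group
  pi1_mulA pi1_mul1 pi1_mulr1 pi1_mulV pi1_mulrV.

End FundamentalGroup.

Section KleinBottle.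
Variable R : realType.

(* The orbits of the group of motions of the plane generated by
   (x, y) |-> (x + 1, - y) and (x, y) |-> (x, y + 1). *)
Definition klein_rel : rel (R * R) := [rel p q | `[< exists m k : int,
  q = (p.1 + m%:~R, (- 1) ^ m * p.2 + k%:~R) >]].

Let sgnV (m : int) : (- 1 : R) ^ (- m) = (- 1) ^ m.
Proof. by rewrite -exprz_inv invrN1. Qed.

Let sgn_int (m k : int) :
  (- 1 : R) ^ m * k%:~R = ((- 1 : int) ^ m * k)%:~R.
Proof. by rewrite intrM !expN1r rmorphXn rmorphN1. Qed.

Let sgnK (m : int) (a : R) : (- 1) ^ m * ((- 1) ^ m * a) = a.
Proof.
by rewrite -{1}sgnV mulrA -expfzDr ?oppr_eq0 ?oner_eq0// addNr expr0z mul1r.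
Qed.

Fact klein_rel_refl : reflexive klein_rel.
Proof.
move=> [a b]; apply/asboolP; exists 0, 0.
by rewrite /= expr0z mul1r !addr0.
Qed.

Let klein_rel_symW p q : klein_rel p q -> klein_rel q p.
Proof.
case: p => a b /asboolP[m [k ->]]; apply/asboolP.
exists (- m), (- ((- 1) ^ m * k)); rewrite /= sgnV mulrDr sgnK sgn_int.
by rewrite !mulrNz !addrK.
Qed.

Fact klein_rel_sym : symmetric klein_rel.
Proof. by move=> p q; apply/idP/idP; exact: klein_rel_symW. Qed.

Fact klein_rel_trans : transitive klein_rel.
Proof.
move=> q [a b] r /asboolP[m [k ->]] /asboolP[m' [k' ->]]; apply/asboolP.
exists (m + m'), ((- 1) ^ m' * k + k'); rewrite /=.
rewrite expfzDr ?oppr_eq0 ?oner_eq0// !intrD -sgn_int.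
by congr (_, _); ring.
Qed.

Canonical klein_equiv :=
  EquivRel klein_rel klein_rel_refl klein_rel_sym klein_rel_trans.

Definition klein_quot := {eq_quot klein_equiv}.

Definition klein_bottle := quotient_topology klein_quot.

HB.instance Definition _ := Topological.on klein_bottle.

End KleinBottle.

Section Graph.
Variable R : realType.

(* The universes of groupClosed and {pred _} are too large for a choiceType,
   hence the unbundled fields and the repackaging by pred_group. *)
Record ghw := Ghw {
  ghw_dim : nat;
  ghw_pred : rigid R ghw_dim -> bool;
  ghw_closed : group_closed ghw_pred;
  ghw_dim_ge2 : (2 <= ghw_dim)%N;
  ghw_GHW : GHW (pred_group ghw_closed)
}.

Definition ghw_group (G : ghw) := subgroup (pred_group (ghw_closed G)).

HB.instance Definition _ := gen_eqMixin ghw.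
HB.instance Definition _ := gen_choiceMixin ghw.

Definition ghw_rel : rel ghw := [rel G H |
  `[< isomorphic (ghw_group G) (ghw_group H) >]].

Fact ghw_rel_refl : reflexive ghw_rel.
Proof.
move=> G; apply/asboolP.
pose f : ghw_group G -> ghw_group G := id.
have fM : {morph f : x y / (x * y)%g} by [].
exists (HB.pack_for {multiplicative _ -> _} f
  (isMultiplicative.Build _ _ f fM)).
by exists id.
Qed.

Let ghw_rel_symW G H : ghw_rel G H -> ghw_rel H G.
Proof.
move=> /asboolP[f [g fK gK]]; apply/asboolP.
have gM : {morph g : x y / (x * y)%g}.
  by move=> x y; apply: (can_inj fK); rewrite gmulfM !gK.
exists (HB.pack_for {multiplicative _ -> _} g
  (isMultiplicative.Build _ _ g gM)).
by exists f.
Qed.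

Fact ghw_rel_sym : symmetric ghw_rel.
Proof. by move=> G H; apply/idP/idP; exact: ghw_rel_symW. Qed.

Fact ghw_rel_trans : transitive ghw_rel.
Proof.
move=> G F H /asboolP[f fb] /asboolP[g gb]; apply/asboolP.
pose h := g \o f.
have hM : {morph h : x y / (x * y)%g} by move=> x y; rewrite /h /= !gmulfM.
exists (HB.pack_for {multiplicative _ -> _} h
  (isMultiplicative.Build _ _ h hM)).
exact: bij_comp.
Qed.

Canonical ghw_equiv :=
  EquivRel ghw_rel ghw_rel_refl ghw_rel_sym ghw_rel_trans.

Definition ghw_vertex := {eq_quot ghw_equiv}.

Definition ghw_edge : rel ghw_vertex := [rel v w | `[< exists G H : ghw,
  [/\ v = \pi_ghw_vertex G, w = \pi_ghw_vertex H,
      ghw_dim H = (ghw_dim G).+1 \/ ghw_dim G = (ghw_dim H).+1 &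
      monomorphic (ghw_group G) (ghw_group H) \/
      monomorphic (ghw_group H) (ghw_group G)] >]].

End Graph.

Definition graph_connected (V : Type) (e : rel V) : Prop :=
  forall v w : V, exists2 p : seq V, path e v p & last v p = w.

(* Main.v *)
Require Import Defs.
From mathcomp Require Import all_boot all_order all_algebra.
From mathcomp Require Import all_classical all_reals all_analysis.
From HB Require Import structures.
From mathcomp Require Import generic_quotient homotopy ring lra zify.

(** The holonomy group H of a generalized Hantzsche-Wendt group of dimension n
    consists of commuting involutions, so it is diagonal in a suitable basis
    and becomes a group of 2^(n-1) sign vectors.  The vector -1 is missing:
    an element with linear part -1 has a fixed point, so its square is the
    identity, against torsion-freeness.  Hence H and -H fill up {1, -1}^n: of
    any two opposite sign vectors exactly one is a holonomy.  This is the form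
    in which the order of H is used throughout (the record [diagonal_crystal];
    the passage to it and back is [GHW_crystal] and [crystal_GHW]).  A first
    consequence is that the sum or difference of a translation and one of its
    conjugates isolates a single coordinate, so that the translation lattice
    has a vector on every axis ([axis_translation]).

    Klein bottle subgroups.  For n >= 2 some holonomy reverses some axis; an
    element a with this holonomy and a translation b along the axis satisfy
    a^-1 b a = b^-1, and in a torsion-free group two nontrivial elements with
    this relation generate the semidirect product [klein_deck] of two infinite
    cyclic groups ([klein_map_inj]).  The fundamental group of the Klein bottle
    embeds in [klein_deck] by lifting loops to the plane: lifts exist by
    [square_lift], their end points depend only on the homotopy class, and two
    loops with the same lifted end points are homotopic because segments join
    the lifts in the plane.  Composing the embeddings gives the first claim.

    Connectedness.  A diagonal group of dimension n + 1 contains one of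
    dimension n ([crystal_slice]): the stabilizer of a hyperplane x_i = c,
    where the axis i is chosen such that the reflection in x_i alone is not a
    holonomy and c is the centre of some reflection of this axis, if the group
    induces one.  The orbit of c is a lattice c + tZ, and a parity argument on
    this lattice shows that the stabilizer has enough holonomies.  Hence every
    vertex is joined to one of dimension 2.  In dimension 2 the diagonal
    groups are all isomorphic to [klein_deck] ([klein_surface]), so there is
    only one such vertex. *)

Set Implicit Arguments.
Unset Strict Implicit.
Unset Printing Implicit Defensive.

Import Order.TTheory GRing.Theory Num.Theory.
Import numFieldNormedType.Exports.
Local Open Scope classical_set_scope.
Local Open Scope ring_scope.
Local Open Scope quotient_scope.

(** * Integer powers and the Klein bottle group *)

Section IntegerPowers.
Variable G : groupType.
Implicit Types (x y : G) (m k : int).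

Definition zpow x m : G :=
  match m with Posz n => (x ^+ n)%g | Negz n => (x ^- n.+1)%g end.

Lemma zpowN x m : zpow x (- m) = (zpow x m)^-1%g.
Proof.
case: m => [[|n]|n]; first by rewrite oppr0 /= expg0 invg1.
  by rewrite -NegzE.
by rewrite NegzE opprK /= invgK.
Qed.

Lemma zpowS x m : zpow x (1 + m) = (x * zpow x m)%g.
Proof.
case: m => [n|[|n]].
- by rewrite -intS /= expgS.
- by rewrite /= expg1 mulgV.
- have -> : 1 + Negz n.+1 = Negz n by lia.
  by rewrite /= (expgSr x n.+1) invgM mulgA mulgV mul1g.
Qed.

Lemma zpowP x m : zpow x (- 1 + m) = (x^-1 * zpow x m)%g.
Proof. by rewrite -{2}[m](addKr (- 1)) opprK zpowS mulKg. Qed.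

Lemma zpowD x m k : zpow x (m + k) = (zpow x m * zpow x k)%g.
Proof.
elim: m => [|m IH|m IH]; first by rewrite add0r mul1g.
- by rewrite intS -addrA !zpowS IH mulgA.
- by rewrite intS opprD -addrA !zpowP IH mulgA.
Qed.

Lemma zpow_conj x y m : (zpow x m ^ y)%g = zpow (x ^ y)%g m.
Proof. by case: m => n /=; rewrite ?conjVg conjXg. Qed.

Lemma zpowV x m : zpow x^-1%g m = zpow x (- m).
Proof. by rewrite zpowN; case: m => n /=; rewrite expVgn. Qed.

Lemma zpow_eq1 x m : (forall k : nat, (0 < k)%N -> (x ^+ k = 1)%g -> x = 1%g) ->
  zpow x m = 1%g -> m != 0 -> x = 1%g.
Proof.
move=> tf; case: m => [[|n]|n] //= xn1 _; first exact: tf xn1.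
by apply: (tf n.+1) => //; apply: invg_inj; rewrite xn1 invg1.
Qed.

Lemma gpred_zpow (S : groupClosed G) x m : x \in S -> zpow x m \in S.
Proof. by move=> xS; case: m => n /=; rewrite ?gpredV gpredXn. Qed.

End IntegerPowers.

(** The multiplication is that of the maps
    (x, y) |-> (x + m, (-1)^m y + k) indexed by (m, k). *)
Definition klein_deck : Type := (int * int)%type.

HB.instance Definition _ := Choice.on klein_deck.

Section KleinDeck.
Implicit Types g h : klein_deck.

Definition kmul g h : klein_deck :=
  (g.1 + h.1, g.2 + (- 1) ^ g.1 * h.2).
Definition kone : klein_deck := (0, 0).
Definition kinv g : klein_deck := (- g.1, - ((- 1) ^ g.1 * g.2)).

Lemma sgnzN (m : int) : (- 1 : int) ^ (- m) = (- 1) ^ m.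
Proof. by rewrite -exprz_inv invrN1. Qed.

Lemma sgnzD (m k : int) : (- 1 : int) ^ (m + k) = (- 1) ^ m * (- 1) ^ k.
Proof. by rewrite exprzDr ?unitrN1. Qed.

Lemma sgnzK (m k : int) : (- 1) ^ m * ((- 1) ^ m * k) = k.
Proof. by rewrite mulrA -{1}sgnzN -sgnzD addNr expr0z mul1r. Qed.

Lemma kmulA : associative kmul.
Proof. by move=> f g h; rewrite /kmul /= sgnzD; congr (_, _); ring. Qed.

Lemma kmul1 : left_id kone kmul.
Proof. by move=> [m k]; rewrite /kmul /= expr0z mul1r !add0r. Qed.

Lemma kmulr1 : right_id kone kmul.
Proof. by move=> [m k]; rewrite /kmul /= mulr0 !addr0. Qed.

Lemma kmulV : left_inverse kone kinv kmul.
Proof. by move=> [m k]; rewrite /kmul /= sgnzN !addNr. Qed.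

Lemma kmulrV : right_inverse kone kinv kmul.
Proof. by move=> [m k]; rewrite /kmul /= mulrN sgnzK !subrr. Qed.

HB.instance Definition _ := isGroup.Build klein_deck
  kmulA kmul1 kmulr1 kmulV kmulrV.

End KleinDeck.

Section KleinPresentation.
Variables (G : groupType) (a b : G).
Hypothesis ab : (b ^ a = b^-1)%g.
Hypothesis tf : forall (g : G) (k : nat), (0 < k)%N -> (g ^+ k = 1)%g -> g = 1%g.

Definition klein_map (g : klein_deck) : G := (zpow b g.2 * zpow a g.1)%g.

Lemma zpow_conj_klein (m k : int) :
  (zpow a m * zpow b k = zpow b ((- 1) ^ m * k) * zpow a m)%g.
Proof.
have abV : (a * b = b^-1 * a)%g.
  by rewrite [RHS]conjgC conjVg ab invgK.
have bV : (b ^ a^-1 = b^-1)%g by rewrite -{1}[b]invgK -ab -conjVg conjgK.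
have step1 k' : (a * zpow b k' = zpow b (- k') * a)%g.
  by rewrite [LHS]conjgCV zpow_conj bV zpowV.
have step2 k' : (a^-1 * zpow b k' = zpow b (- k') * a^-1)%g.
  by rewrite [LHS]conjgCV zpow_conj invgK ab zpowV.
elim: m k => [|m IH|m IH] k; first by rewrite expr0z mul1r mulg1 mul1g.
- rewrite intS zpowS -mulgA IH !mulgA step1 sgnzD expr1z mulN1r.
  by rewrite mulNr.
- rewrite intS opprD zpowP -mulgA IH !mulgA step2 sgnzD
    (_ : (- 1) ^ (- 1) = - 1)// mulN1r.
  by rewrite mulNr.
Qed.

Lemma klein_mapM : {morph klein_map : g h / (g * h)%g}.
Proof.
move=> [m k] [m' k']; rewrite /klein_map /= !zpowD !mulgA; congr (_ * _)%g.
by rewrite -!mulgA zpow_conj_klein.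
Qed.

(** If b^k a^m = 1, then b^k is a power of a, so it commutes with a; as a also
    inverts it, b^(2k) = 1.  Torsion-freeness leaves k = 0, then m = 0. *)
Lemma klein_map_inj : a != 1%g -> b != 1%g -> injective klein_map.
Proof.
move=> a1 b1.
have inj1 g : klein_map g = 1%g -> g = 1%g.
  case: g => m k; rewrite /klein_map /= => mk1.
  have kE : zpow b k = zpow a (- m).
    by rewrite zpowN; apply: (mulIg (zpow a m)); rewrite mk1 mulVg.
  have k0 : k = 0.
    apply/eqP/negPn/negP => k0; move/eqP: b1; apply.
    apply: (@zpow_eq1 _ b (k + k)); [exact: tf| |by lia].
    have kV : (zpow b k = (zpow b k)^-1)%g.
      rewrite -[RHS]zpowN -zpowV -ab -zpow_conj kE.
      by rewrite zpow_conj conjgE mulKg.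
    by rewrite zpowD {2}kV mulgV.
  move: mk1; rewrite k0 mul1g => am; congr (_, _).
  apply/eqP/negPn/negP => m0; move/eqP: a1; apply.
  by apply: zpow_eq1 am m0; exact: tf.
move=> g h gh; apply/eqP; rewrite -divg_eq1; apply/eqP/inj1.
have := klein_mapM (g * h^-1)%g h; rewrite mulgVK gh => /esym/eqP.
by rewrite -[X in _ == X]mul1g => /eqP/mulIg.
Qed.

End KleinPresentation.

(** * Lifting loops of the Klein bottle to the plane *)

Section KleinCover.
Variable R : realType.
Local Notation plane := (R * R)%type.
Local Notation X := (klein_bottle R).

Definition kproj (z : plane) : X := \pi_(klein_quot R) z.

Definition kact (g : klein_deck) (z : plane) : plane :=
  (z.1 + g.1%:~R, (- 1) ^ g.1 * z.2 + g.2%:~R).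

Lemma sgnz_int (m k : int) : ((- 1) ^ m * k)%:~R = (- 1) ^ m * k%:~R :> R.
Proof. by rewrite intrM !expN1r rmorphXn rmorphN1. Qed.

Lemma kactM (g h : klein_deck) z : kact (g * h)%g z = kact g (kact h z).
Proof.
case: g h => [m k] [m' k']; rewrite /kact /= !intrD sgnz_int.
rewrite expfzDr ?oppr_eq0 ?oner_eq0//.
by congr (_, _); ring.
Qed.

Lemma kact1 z : kact 1%g z = z.
Proof. by case: z => x y; rewrite /kact /= expr0z mul1r !addr0. Qed.

Lemma normr_sgnz (m : int) : `|(- 1 : R) ^ m| = 1.
Proof. by rewrite expN1r normrX normrN1 expr1n. Qed.

Lemma kact_iso g z w : `|kact g z - kact g w| = `|z - w|.
Proof.
rewrite !prod_normE /=; congr (Num.max _ _).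
  by rewrite opprD addrACA subrr addr0.
by rewrite opprD addrACA subrr addr0 -mulrBr normrM normr_sgnz mul1r.
Qed.

(** A nontrivial deck motion moves every point by at least 1: this uniform
    gap replaces evenly covered neighbourhoods in all that follows. *)
Lemma kact_sep g z : `|kact g z - z| < 1 -> g = 1%g.
Proof.
have int_small (m : int) : `|m%:~R : R| < 1 -> m = 0.
  by rewrite -intr_norm -[1]/(1%:~R) ltr_int => m1; lia.
case: g z => [m k] [x y]; rewrite prod_normE gt_max /= => /andP[].
rewrite addrAC subrr add0r => /int_small ->; rewrite expr0z mul1r.
by rewrite addrAC subrr add0r => /int_small ->.
Qed.

Lemma kproj_eqP z w : kproj z = kproj w <-> exists g, w = kact g z.
Proof.
rewrite /kproj; split.
  by move/eqmodP/asboolP => [m [k ->]]; exists (m, k).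
by case=> -[m k] ->; apply/eqmodP/asboolP; exists m, k.
Qed.

Lemma kproj_kact g z : kproj (kact g z) = kproj z.
Proof. by apply/esym/kproj_eqP; exists g. Qed.

Lemma kproj_inj_near z w : kproj z = kproj w -> `|w - z| < 1 -> z = w.
Proof. by case/kproj_eqP => g -> /kact_sep ->; rewrite kact1. Qed.

Lemma kproj_continuous : continuous kproj.
Proof. exact: pi_continuous. Qed.

Lemma kact_continuous g : continuous (kact g).
Proof.
move=> z; apply/cvgrPdist_lt => e e0.
have /cvgrPdist_lt/(_ e e0) : @id plane z' @[z' --> z] --> z by exact: cvg_id.
by apply: filterS => w; rewrite kact_iso.
Qed.

(** The saturation of an open set is the union of its preimages by the deck
    motions. *)
Lemma kproj_open (U : set plane) : open U -> open (kproj @` U).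
Proof.
move=> oU; rewrite /open /= /quotient_open.
rewrite (_ : _ @^-1` _ = \bigcup_g (kact g @^-1` U)); last first.
  apply/seteqP; split=> [z [w Uw /esym/kproj_eqP[g wE]]|z [g _ Uz]].
    by exists g => //; rewrite /= -wE.
  by exists (kact g z) => //; exact: kproj_kact.
by apply: bigcup_open => g _; apply: open_comp oU => z _; exact: kact_continuous.
Qed.

Lemma near_kproj z (e : R) : 0 < e ->
  \forall y \near kproj z, exists2 w, kproj w = y & `|w - z| < e.
Proof.
move=> e0; have : nbhs (kproj z) (kproj @` ball z e).
  apply: open_nbhs_nbhs; split; first exact/kproj_open/ball_open.
  by exists z => //; exact: ballxx.
apply: filterS => y [w bw <-]; exists w => //.
by move: bw; rewrite -ball_normE /= distrC.
Qed.

(** A continuous map that stays close to the projection of a lifted map can be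
    lifted itself: the lift within distance 1/4 is unique by the gap of 1
    between the points of a fibre, and this uniqueness forces its continuity. *)
Lemma lift_step (T : topologicalType) (F : T -> plane) (G : T -> X) :
  continuous F -> continuous G ->
  (forall u, exists2 z, kproj z = G u & `|z - F u| < 4^-1) ->
  exists F' : T -> plane, [/\ continuous F', forall u, kproj (F' u) = G u &
    forall u, `|F' u - F u| < 4^-1].
Proof.
move=> cF cG FG.
have [F' F'P] := @choice T plane (fun u z => kproj z = G u /\ `|z - F u| < 4^-1)
  (fun u => let: ex_intro2 z zG zF := FG u in ex_intro _ z (conj zG zF)).
exists F'; split=> [u|u|u]; [|by case: (F'P u)|by case: (F'P u)].
apply/cvgrPdist_lt => e e0.
pose d := Num.min e 4^-1.
have d0 : 0 < d by rewrite lt_min e0 invr_gt0 ltr0n.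
have /cG : \forall y \near G u, exists2 w, kproj w = y & `|w - F' u| < d.
  by rewrite -(F'P u).1; exact: near_kproj.
have /cvgrPdist_lt/(_ 4^-1) := cF u.
rewrite invr_gt0 ltr0n => /(_ isT); apply: filterS2 => v Fuv /= [w wG wF'].
suff -> : F' v = w.
  by rewrite distrC; apply: lt_le_trans wF' _; rewrite ge_min lexx.
apply/esym/kproj_inj_near; first by rewrite wG (F'P v).1.
have wF4 : `|w - F' u| < 4^-1.
  by apply: lt_le_trans wF' _; rewrite ge_min lexx orbT.
have -> : F' v - w = (F' v - F v) - (F u - F v) - (F' u - F u) - (w - F' u).
  by rewrite !opprB; apply/eqP; rewrite -subr_eq0; apply/eqP; ring.
have := (F'P v).2; have := (F'P u).2.
move: (F' v - F v) (F u - F v) (F' u - F u) (w - F' u) Fuv wF4 => a b c d'.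
move=> b4 d4 c4 a4.
have := ler_normB (a - b - c) d'; have := ler_normB (a - b) c.
have := ler_normB a b.
lra.
Qed.

(** A Lebesgue number: on a compact set, nearby points have images with nearby
    lifts. *)
Lemma kproj_uniform (H : plane -> X) (K : set plane) :
  continuous H -> compact K ->
  exists2 e : R, 0 < e & forall u v, K u -> `|u - v| < e ->
    exists z w, [/\ kproj z = H u, kproj w = H v & `|w - z| < 4^-1].
Proof.
move=> cH /compact_near_coveringP cK.
have : \forall e \near 0^'+, K `<=` (fun u => forall v, `|u - v| < e ->
    exists z w, [/\ kproj z = H u, kproj w = H v & `|w - z| < 4^-1]).
  apply: cK.
  move=> u Ku; pose z := repr (H u).
  have zE : kproj z = H u by rewrite /kproj reprK.
  have /cH : \forall y \near H u, exists2 w, kproj w = y & `|w - z| < 8^-1.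
    by rewrite -zE; apply: near_kproj; rewrite invr_gt0 ltr0n.
  case/nbhs_ballP => r /= r0 Hr.
  exists (ball u (r / 2), [set e | e < r / 2]).
    split; first by apply: nbhsx_ballx; rewrite divr_gt0.
    by apply: nbhs_right_lt; rewrite divr_gt0.
  move=> [v e] /= [uv er] w vw.
  have [//|z1 z1E z1z] := Hr v.
    by apply: le_ball uv; lra.
  have [|z2 z2E z2z] := Hr w.
    rewrite (splitr r); apply: ball_triangle uv _.
    by rewrite -ball_normE /=; apply: lt_trans vw er.
  exists z1, z2; split=> //.
  have := ler_distD z z2 z1; rewrite (distrC z z1); lra.
move=> Ke; have [e [Ke' e0]] := filter_ex (filterI Ke (nbhs_right_gt (0 : R))).
by exists e => // u v /Ke'; apply.
Qed.

Definition clamp2 (u : plane) : plane := (clamp u.1, clamp u.2).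

Lemma clamp2_continuous : continuous clamp2.
Proof.
apply: (@continuous_pair plane R R) => u; apply: continuous_comp;
  by [exact: cvg_fst|exact: cvg_snd|exact: continuous_clamp].
Qed.

Lemma clamp01 (t : R) : 0 <= clamp t <= 1.
Proof.
by rewrite /clamp le_max lexx ge_max ler01 ge_min lexx.
Qed.

(** The square is contracted to its corner 0 in small steps, along which the
    map varies little uniformly; starting from a constant lift of the constant
    map, [lift_step] is applied once for each step.  In this way the square is
    never cut into pieces on which separate lifts have to be glued. *)
Lemma square_lift (H : plane -> X) (z0 : plane) :
  continuous H -> kproj z0 = H 0 ->
  exists F : plane -> plane, [/\ continuous F, F 0 = z0 &
    forall u, kproj (F u) = H (clamp2 u)].
Proof.
move=> cH z0E.
have [e e0 eP] : exists2 e : R, 0 < e & forall u v : plane,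
    (`[0, 1] `*` `[0, 1]) u -> `|u - v| < e -> exists z w,
    [/\ kproj z = H u, kproj w = H v & `|w - z| < 4^-1].
  by apply: kproj_uniform => //; apply: compact_setX; exact: segment_compact.
(* The contraction takes N + 1 steps, each moving the points by less than e. *)
have [N Ne] : exists N : nat, N.+1%:R^-1 < e.
  by have [N _ /(_ N (leqnn N))] := near_infty_natSinv_lt (PosNum e0); exists N.
pose c k u : plane := (k%:R / N.+1%:R) *: clamp2 u.
have c0 k : c k 0 = 0.
  by rewrite /c /clamp2 /= clamp_id ?lexx ?ler01// (_ : (0, 0) = 0)// scaler0.
have cc k : continuous (c k).
  by move=> u; apply: cvgZr; exact: clamp2_continuous.
suff /(_ N.+1 (leqnn _)) [F [cF F0 FH]] : forall k, (k <= N.+1)%N ->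
    exists F : plane -> plane, [/\ continuous F, F 0 = z0 &
    forall u, kproj (F u) = H (c k u)].
  by exists F; split=> // u; rewrite FH /c divff ?pnatr_eq0// scale1r.
elim=> [_|k IH kN].
  exists (cst z0); split=> [|//|u]; first exact: cst_continuous.
  by rewrite /c mul0r scale0r.
have [F [cF F0 FH]] := IH (ltnW kN).
have [|u|F' [cF' F'H F'F]] := @lift_step _ F (H \o c k.+1) cF.
- by move=> u; apply: continuous_comp; [exact: cc|exact: cH].
- have [||z [w [zE wE zw]]] := eP (c k u) (c k.+1 u).
  + have k01 : 0 <= (k%:R / N.+1%:R : R) <= 1.
      by rewrite divr_ge0//= ler_pdivrMr ?ltr0n// mul1r ler_nat ltnW.
    have := clamp01 u.1; have := clamp01 u.2; case/andP: k01 => k0 k1.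
    move=> /andP[a0 a1] /andP[b0 b1].
    by split; rewrite /= in_itv /=; rewrite mulr_ge0//= mulr_ile1.
  + rewrite /c -scalerBl -mulrBl -natr1 opprD addNKr normrZ.
    apply: le_lt_trans Ne; rewrite normrM normrN1 mul1r.
    rewrite ger0_norm ?invr_ge0// ler_piMr ?invr_ge0// prod_normE ge_max /=.
    have /andP[a0 a1] := clamp01 u.1; have /andP[b0 b1] := clamp01 u.2.
    by rewrite !ger0_norm// a1.
  + have [g gE] : exists g, F u = kact g z by apply/kproj_eqP; rewrite zE FH.
    by exists (kact g w); rewrite ?kproj_kact// gE kact_iso.
- exists F'; split=> //.
  apply/esym/kproj_inj_near; first by rewrite z0E F'H /= c0.
  by rewrite -F0; apply: lt_trans (F'F 0) _; rewrite invf_lt1 ?ltr0n// ltr1n.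
Qed.


Variable x : X.
Let z0 := repr x.
Let kprojz0 : kproj z0 = x. Proof. by rewrite /kproj reprK. Qed.
Local Notation I := (unit_interval R).
Local Notation loop := {path I from x to x}.

Definition lifts_to (p : loop) (g : klein_deck) : Prop :=
  exists f : I -> plane, [/\ continuous f, forall t, kproj (f t) = p t,
    f zero = z0 & f one = kact g z0].

(** The distance between two lifts of the same path is continuous and takes no
    value in the open interval (0, 1). *)
Lemma lift_unique (f f' : I -> plane) : continuous f -> continuous f' ->
  (forall t, kproj (f t) = kproj (f' t)) -> f zero = f' zero -> f one = f' one.
Proof.
move=> cf cf' ff' ff'0.
pose n (t : R) := `|f (iclamp t) - f' (iclamp t)|.
have cn : continuous n.
  move=> t; apply: cvg_norm.
  by apply: cvgB; (apply: continuous_comp; [exact: continuous_iclamp|]);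
    [exact: cf|exact: cf'].
have n01 t : n t < 1 -> n t = 0.
  rewrite /n => n1; apply/eqP; rewrite normr_eq0 subr_eq0; apply/eqP.
  by apply: kproj_inj_near; rewrite ?ff'// distrC.
have n0 : n 0 = 0 by rewrite /n -[iclamp 0]/(zero : I) ff'0 subrr normr0.
have : n 1 < 1.
  rewrite ltNge; apply/negP => n1.
  have [||c _ nc] := @IVT R n 0 1 (2^-1) ler01.
  - exact: continuous_subspaceT.
  - have n10 : 0 <= n 1 by exact: le_trans ler01 n1.
    by rewrite n0 (min_l n10) (max_r n10) invr_ge0 ler0n/=; lra.
  - by have := n01 c; rewrite nc invf_lt1 ?ltr0n// ltr1n => /(_ isT) /eqP;
      rewrite invr_eq0 pnatr_eq0.
move/n01/eqP; rewrite normr_eq0 subr_eq0 => /eqP; exact.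
Qed.

Lemma lifts_exist (p : loop) : exists g, lifts_to p g.
Proof.
pose H (u : plane) := p (iclamp u.1).
have cH : continuous H.
  apply: continuous_ipath => u; exact: cvg_fst.
have H0 : kproj z0 = H 0.
  by rewrite kprojz0 /H -[LHS](@path_zero _ _ _ _ p).
have [F [cF F0 FH]] := square_lift cH H0.
pose f (t : I) := F (\val t, 0).
have fp t : kproj (f t) = p t by rewrite FH /H /= -iclampE !iclampK.
have f0 : f zero = z0.
  by rewrite /f ival_zero -F0.
have [g gE] : exists g, f one = kact g z0.
  by apply/kproj_eqP; rewrite fp (@path_one _ _ _ _ p).
exists g; exists f; split=> //.
move=> t; apply: (@continuous_comp _ _ _ (fun t : I => (\val t, 0 : R)) F);
  last exact: cF.
move: t; apply: continuous_pair; first exact: continuous_ival.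
exact: cst_continuous.
Qed.

(** In the lift of the homotopy, the two vertical sides of the square lie in the
    fibre of the base point; they are constant by uniqueness of lifts. *)
Lemma lifts_homotopic (p p' : loop) (g g' : klein_deck) :
  homotopic p p' -> lifts_to p g -> lifts_to p' g' -> g = g'.
Proof.
case=> K [cK K0 K1 Kx Ky] [f [cf fp f0 f1]] [f' [cf' fp' f'0 f'1]].
pose H (u : plane) := K (iclamp u.1, iclamp u.2).
have cH : continuous H.
  move=> u; apply: (@continuous_comp _ _ _ (fun u : plane =>
    (iclamp u.1, iclamp u.2)) K); last exact: cK.
  move: u; apply: (@continuous_pair plane I I) => u; apply: continuous_comp;
    by [exact: cvg_fst|exact: cvg_snd|exact: continuous_iclamp].
have H0 : kproj z0 = H 0 by rewrite kprojz0 /H Kx.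
have [F [cF F0 FH]] := square_lift cH H0.
have FK (t s : I) : kproj (F (\val t, \val s)) = K (t, s).
  by rewrite FH /H /= -!iclampE !iclampK.
have c1 (s : R) : continuous (fun t : I => F (\val t, s)).
  move=> t; apply: (@continuous_comp _ _ _ (fun t : I => (\val t, s)) F);
    last exact: cF.
  move: t; apply: continuous_pair; first exact: continuous_ival.
  exact: cst_continuous.
have c2 (t : R) : continuous (fun s : I => F (t, \val s)).
  move=> s; apply: (@continuous_comp _ _ _ (fun s : I => (t, \val s)) F);
    last exact: cF.
  move: s; apply: continuous_pair; last exact: continuous_ival.
  exact: cst_continuous.
have F00 : F (\val (zero : I), \val (zero : I)) = z0 by rewrite ival_zero F0.
have F01 : z0 = F (\val (zero : I), \val (one : I)).
  have := @lift_unique (fun=> z0)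
    (fun s : I => F (\val (zero : I), \val s)) _ (c2 _).
  apply => //.
    exact: cst_continuous.
  by move=> s; rewrite kprojz0 FK Kx.
have F10 : F (\val (one : I), \val (zero : I)) = kact g z0.
  by rewrite -f1; apply: (lift_unique (c1 _) cf) => [t|];
    rewrite ?F00 ?f0// FK K0 fp.
have F11 : F (\val (one : I), \val (one : I)) = kact g' z0.
  by rewrite -f'1; apply: (lift_unique (c1 _) cf') => [t|];
    rewrite -?F01 ?f'0// FK K1 fp'.
have gg' : kact g z0 = kact g' z0.
  rewrite -F11; 
  have := @lift_unique (fun=> kact g z0)
    (fun s : I => F (\val (one : I), \val s)) _ (c2 _).
  apply => //.
    exact: cst_continuous.
  by move=> s; rewrite FK Ky kproj_kact kprojz0.
have : (g^-1 * g')%g = 1%g.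
  apply: (@kact_sep _ z0); rewrite kactM -gg' -kactM mulVg kact1 subrr normr0.
  exact: ltr01.
by move=> /mulg1_eq; rewrite invgK.
Qed.

(** The lifts have the same end points, and the plane is convex: the segments
    between the lifts project to a homotopy. *)
Lemma homotopic_lifts (p p' : loop) (g : klein_deck) :
  lifts_to p g -> lifts_to p' g -> homotopic p p'.
Proof.
case=> f [cf fp f0 f1] [f' [cf' fp' f'0 f'1]].
pose H (z : I * I) := (1 - \val z.2) *: f z.1 + \val z.2 *: f' z.1.
exists (fun z => kproj (H z)); split=> [|t|t|s|s].
- move=> z; apply: continuous_comp; last exact: kproj_continuous.
  have cfst (h : I -> plane) :
      continuous h -> {for z, continuous (h \o fst : I * I -> _)}.
    by move=> ch; apply: continuous_comp; [exact: cvg_fst|exact: ch].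
  apply: cvgD; apply: cvgZ.
  + exact: (continuous_rsub (@continuous_ival2 R)).
  + exact: cfst cf.
  + exact: continuous_ival2.
  + exact: cfst cf'.
- by rewrite /H ival_zero subr0 scale1r scale0r addr0 fp.
- by rewrite /H ival_one subrr scale0r scale1r add0r fp'.
- by rewrite /H /= f0 f'0 -scalerDl subrK scale1r.
- by rewrite /H /= f1 f'1 -scalerDl subrK scale1r kproj_kact.
Qed.

Lemma lifts_concat (p p' : loop) (g g' : klein_deck) :
  lifts_to p g -> lifts_to p' g' -> lifts_to (concat p p') (g * g')%g.
Proof.
case=> f [cf fp f0 f1] [f' [cf' fp' f'0 f'1]].
exists (fun t => if \val t - 2^-1 <= 0 then f (iclamp (2 * \val t))
  else kact g (f' (iclamp (2 * \val t - 1)))); split.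
- have c2 : continuous (fun t : I => 2 * \val t).
    have := @continuous_affine R I 2 0 _ (@continuous_ival R).
    by under eq_fun do rewrite addr0.
  apply: paste_continuous.
  + exact/continuous_subr/continuous_ival.
  + move=> t; apply: continuous_comp; last exact: cf.
    by apply: continuous_comp; [exact: c2|exact: continuous_iclamp].
  + move=> t; apply: continuous_comp; last exact: kact_continuous.
    apply: continuous_comp; last exact: cf'.
    apply: continuous_comp; last exact: continuous_iclamp.
    exact: continuous_subr.
  + move=> t /eqP; rewrite subr_eq0 => /eqP ->.
    by rewrite mulfV// subrr f1 f'0.
- by move=> t; rewrite concatE subr_le0; case: ifP => _; rewrite ?kproj_kact.
- by rewrite ival_zero sub0r oppr_le0 invr_ge0 ler0n mulr0 f0.
- rewrite ival_one ifF; last by apply/negbTE; rewrite -ltNge; lra.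
  by rewrite mulr1 -addrA subrr addr0 f'1 kactM.
Qed.

Definition deck_of (a : fundamental_group R x) : klein_deck :=
  projT1 (cid (lifts_exist (repr a))).

Lemma deck_ofP (p : loop) g : lifts_to p g ->
  deck_of (\pi_(fundamental_group R x) p) = g.
Proof.
rewrite /deck_of; case: cid => h /= ph pg.
by apply: lifts_homotopic ph pg; exact: pi1_repr.
Qed.

Lemma deck_of_lifts a : lifts_to (repr a) (deck_of a).
Proof. by rewrite /deck_of; case: cid. Qed.

Lemma deck_ofM : {morph deck_of : a b / (a * b)%g}.
Proof.
by move=> a b; apply: deck_ofP; apply: lifts_concat; exact: deck_of_lifts.
Qed.

Lemma deck_of_inj : injective deck_of.
Proof.
move=> a b ab; rewrite -[a]reprK -[b]reprK; apply/pi1_eqP.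
by apply: homotopic_lifts (deck_of_lifts a) _; rewrite ab; exact: deck_of_lifts.
Qed.


End KleinCover.

(** * Crystallographic groups with diagonal linear parts *)

(** Two positive elements of X whose quotients by d have the same integer part
    are equal.  So a positive element that minimizes this integer part is the
    least positive element, and Euclidean division by it shows that it
    generates. *)
Lemma discrete_subgroup_cyclic (R : archiRealFieldType) (X : R -> Prop) (d : R) :
  0 < d -> X 0 -> (forall x y, X x -> X y -> X (x - y)) ->
  (forall x, X x -> `|x| < d -> x = 0) ->
  exists2 t, X t & forall x, X x -> exists m : int, x = m%:~R * t.
Proof.
move=> d0 X0 XB Xd.
have XN x : X x -> X (- x) by move=> Xx; rewrite -[- x]add0r; exact: XB.
have XD x y : X x -> X y -> X (x + y).
  by move=> Xx Xy; rewrite -[y]opprK; apply: XB => //; exact: XN.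
have Xn x (k : nat) : X x -> X (k%:R * x).
  move=> Xx; elim: k => [|k IH]; first by rewrite mul0r.
  by rewrite -natr1 mulrDl mul1r; exact: XD.
have Xz x (m : int) : X x -> X (m%:~R * x).
  move=> Xx; case: m => k; first exact: Xn.
  by rewrite NegzE mulrNz mulNr; apply: XN; exact: Xn.
have [[x0 [Xx0 x00]]|none] := pselect (exists x, X x /\ 0 < x); last first.
  exists 0 => // x Xx; exists 0; rewrite mulr0.
  have [x0|x0|//] := ltgtP x 0; exfalso; apply: none; last by exists x.
  by exists (- x); rewrite oppr_gt0; split => //; exact: XN.
pose P k := `[< exists x, [/\ X x, 0 < x & Num.truncn (x / d) = k] >].
have exP : exists k, P k by exists (Num.truncn (x0 / d)); apply/asboolP; exists x0.
case: (ex_minnP exP) => k /asboolP[t [Xt t0 tk]] kmin.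
have tmin y : X y -> 0 < y -> t <= y.
  move=> Xy y0; have [//|yt] := leP t y.
  have ky : (k <= Num.truncn (y / d))%N by apply: kmin; apply/asboolP; exists y.
  have yd0 : 0 <= y / d by rewrite divr_ge0// ltW.
  have td0 : 0 <= t / d by rewrite divr_ge0// ltW.
  have /andP[y1 _] := truncn_itv yd0; have /andP[_ t2] := truncn_itv td0.
  have : k%:R <= y / d by apply: le_trans y1; rewrite ler_nat.
  rewrite tk in t2; move: t2.
  rewrite ltr_pdivrMr// ler_pdivlMr// -natr1 mulrDl mul1r => tk1 yk1.
  have := Xd (t - y) (XB _ _ Xt Xy); rewrite ger0_norm ?subr_ge0 ?ltW//.
  by move=> H; have : t - y = 0 by [apply: H; lra]; lra.
exists t => // x Xx; exists (Num.floor (x / t)).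
have := XB _ _ Xx (Xz _ (Num.floor (x / t)) Xt).
have /andP[f1 f2] := floor_itv (x / t).
move: f1 f2; rewrite ler_pdivlMr// ltr_pdivrMr// intrD mulrDl mul1r.
move: (_ * t) => y f1 f2 Xy; apply/eqP; rewrite -subr_eq0; apply/eqP.
have [//|xy|//] := ltgtP (x - y) 0; first lra.
by have := tmin _ Xy xy; lra.
Qed.

Section Diagonal.
Variables (R : realType) (n : nat).
Implicit Types g h : rigid R n.

Definition sgn g i : R := linear_part g i i.
Definition tr g i : R := translation_part g i 0.
Definition diag_motion g : bool := is_diag_mx (linear_part g).

Lemma linear_diag_motion g : diag_motion g ->
  linear_part g = diag_mx (\row_i sgn g i).
Proof.
move=> /is_diag_mxP dg; apply/matrixP => i j; rewrite !mxE.
by have [->|ij] := eqVneq i j; rewrite ?mulr1n// mulr0n dg.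
Qed.

Lemma sgn_mul g h i : diag_motion g -> sgn (g * h)%g i = sgn g i * sgn h i.
Proof.
by move=> /linear_diag_motion dg; rewrite /sgn /= {1}dg mul_diag_mx !mxE.
Qed.

Lemma tr_mul g h i : diag_motion g ->
  tr (g * h)%g i = sgn g i * tr h i + tr g i.
Proof.
by move=> /linear_diag_motion dg; rewrite /tr /= {1}dg mul_diag_mx !mxE.
Qed.

Lemma sgn1 i : sgn 1%g i = 1.
Proof. by rewrite /sgn /= mxE eqxx. Qed.

Lemma tr1 i : tr 1%g i = 0.
Proof. by rewrite /tr /= mxE. Qed.

Lemma diag_motion1 : diag_motion 1%g.
Proof. exact: scalar_mx_is_diag. Qed.

Lemma diag_motionM g h : diag_motion g -> diag_motion h -> diag_motion (g * h)%g.
Proof.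
move=> /linear_diag_motion dg /linear_diag_motion dh.
by rewrite /diag_motion /= dg dh mulmx_diag diag_mx_is_diag.
Qed.

Lemma diag_motionV g : diag_motion g -> diag_motion g^-1%g.
Proof.
move=> /linear_diag_motion dg.
by rewrite /diag_motion /= dg tr_diag_mx diag_mx_is_diag.
Qed.

Lemma sgnV g i : sgn g^-1%g i = sgn g i.
Proof. by rewrite /sgn /= mxE. Qed.

Lemma sgn_sqr g i : diag_motion g -> sgn g i * sgn g i = 1.
Proof. by move=> dg; rewrite -{1}sgnV -sgn_mul ?diag_motionV// mulVg sgn1. Qed.

Lemma trV g i : diag_motion g -> tr g^-1%g i = - (sgn g i * tr g i).
Proof.
move=> dg; have := tr1 i; rewrite -(mulgV g) tr_mul// => /eqP.
rewrite addrC addr_eq0 => /eqP ->.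
by rewrite mulrN opprK mulrA sgn_sqr// mul1r.
Qed.

Lemma sgnP g i : diag_motion g -> {sgn g i = 1} + {sgn g i = - 1}.
Proof.
move=> dg; have /eqP := sgn_sqr i dg; rewrite -expr2 sqrf_eq1.
by case: eqP => [|_ /= /eqP]; [left|right].
Qed.

Lemma diag_motion_inj g h : diag_motion g -> diag_motion h ->
  sgn g =1 sgn h -> tr g =1 tr h -> g = h.
Proof.
move=> dg dh gh gh'; apply: rigid_pair_inj; congr (_, _).
  rewrite !linear_diag_motion//; congr diag_mx; apply/rowP => i.
  by rewrite !mxE gh.
by apply/colP => i; exact: gh'.
Qed.

Fact sign_motion_subproof (s : 'I_n -> bool)
    (A := diag_mx (\row_i (- 1) ^+ s i) : 'M[R]_n) :
  A^T *m A == 1%:M.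
Proof.
rewrite tr_diag_mx mulmx_diag -diag_const_mx; apply/eqP; congr diag_mx.
by apply/rowP => i; rewrite !mxE -expr2 sqrr_sign.
Qed.

Definition sign_motion (s : 'I_n -> bool) (a : 'I_n -> R) : rigid R n :=
  Rigid (\col_i a i) (sign_motion_subproof s).

Lemma sign_motion_diag s a : diag_motion (sign_motion s a).
Proof. exact: diag_mx_is_diag. Qed.

Lemma sgn_sign_motion s a i : sgn (sign_motion s a) i = (- 1) ^+ s i.
Proof. by rewrite /sgn !mxE eqxx mulr1n. Qed.

Lemma tr_sign_motion s a i : tr (sign_motion s a) i = a i.
Proof. by rewrite /tr !mxE. Qed.

(** In positive dimension, a group of motions with diagonal linear parts is a
    generalized Hantzsche-Wendt group if and only if it satisfies these
    conditions.  The elements in [dc_free] are those with a fixed point.  The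
    last condition says that every sign vector or its opposite is a holonomy:
    with [dc_free], which excludes the vector -1, this means that the holonomy
    group has index 2 in the group of all sign vectors. *)
Record diagonal_crystal (D : groupClosed (rigid R n)) : Prop := DiagonalCrystal {
  dc_diagonal : forall g, g \in D -> diag_motion g;
  dc_free : forall g, g \in D -> (forall i, sgn g i = 1 -> tr g i = 0) -> g = 1%g;
  dc_discrete : exists2 d : R, 0 < d & forall g, g \in D ->
    (forall i, sgn g i = 1) -> (forall i, `|tr g i| < d) -> g = 1%g;
  dc_translation : forall i, exists2 g, g \in D &
    (forall j, sgn g j = 1) /\ tr g i != 0;
  dc_holonomy : forall s : 'I_n -> bool, exists2 g, g \in D &
    exists b, forall i, sgn g i = (- 1) ^+ (s i (+) b)
}.

Section Crystal.
Variables (D : groupClosed (rigid R n)) (dcD : diagonal_crystal D).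

Lemma sgnM g h i : g \in D -> sgn (g * h)%g i = sgn g i * sgn h i.
Proof. by move=> /(dc_diagonal dcD); exact: sgn_mul. Qed.

Lemma trM g h i : g \in D -> tr (g * h)%g i = sgn g i * tr h i + tr g i.
Proof. by move=> /(dc_diagonal dcD); exact: tr_mul. Qed.

Lemma tr_inv g i : g \in D -> tr g^-1%g i = - (sgn g i * tr g i).
Proof. by move=> /(dc_diagonal dcD); exact: trV. Qed.

Lemma sgn_cases g i : g \in D -> {sgn g i = 1} + {sgn g i = - 1}.
Proof. by move=> /(dc_diagonal dcD); exact: sgnP. Qed.

Lemma sgnK g i : g \in D -> sgn g i * sgn g i = 1.
Proof. by move=> /(dc_diagonal dcD); exact: sgn_sqr. Qed.

(** Some holonomy k is, up to a global sign, the reflection in the coordinate i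
    alone.  The square l of g is a translation, and adding to l its conjugate by
    k, or subtracting it, doubles the coordinate i and kills the others. *)
Lemma axis_translation g i : g \in D -> sgn g i = 1 ->
  exists2 h, h \in D & [/\ forall j, sgn h j = 1, tr h i = 4 * tr g i &
    forall j, j != i -> tr h j = 0].
Proof.
move=> gD gi.
have [l [lD sl li]] : exists l, [/\ l \in D, forall j, sgn l j = 1 &
    tr l i = 2 * tr g i].
  exists (g * g)%g; split; first by rewrite gpredM.
    by move=> j; rewrite sgnM// sgnK.
  by rewrite trM// gi; ring.
have [k kD [b kb]] := dc_holonomy dcD (fun j => j != i).
have [m [mD sm tm]] : exists m, [/\ m \in D, forall j, sgn m j = 1 &
    forall j, tr m j = sgn k j * tr l j].
  exists (k * l * k^-1)%g; split => [|j|j].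
    by rewrite gpredM ?gpredV// gpredM.
    by rewrite !sgnM ?gpredM// sgnV sl mulr1 sgnK.
  rewrite trM ?gpredM// sgnM// trM// tr_inv// sl mulr1.
  by rewrite mulrN mulrA sgnK// mul1r addrCA addNr addr0.
exists (if b then l * m^-1 else l * m)%g.
  by case: b {kb}; rewrite gpredM ?gpredV.
case: b kb => kb; split=> [j||j ji];
  rewrite ?sgnM ?trM ?gpredV// ?sgnV ?sl ?sm ?mul1r//.
- by rewrite tr_inv// sm tm kb eqxx li /= expr1; ring.
- by rewrite tr_inv// sm tm kb ji /= expr0; ring.
- by rewrite tm kb eqxx li /= expr0; ring.
- by rewrite tm kb ji /= expr1; ring.
Qed.

(** Here c is the centre of a reflection of the axis i induced by some element,
    or 0 if there is none.  The translations along this axis induced by the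
    group form a discrete set, as four times such a translation comes from an
    element of the group by [axis_translation]. *)
Lemma axis_cyclic i : exists c t : R,
  (forall g, g \in D -> exists m : int, sgn g i * c + tr g i = c + m%:~R * t) /\
  exists2 g, g \in D & sgn g i = 1 /\ tr g i = t.
Proof.
pose X x := exists2 g, g \in D & sgn g i = 1 /\ tr g i = x.
have [d d0 Dd] := dc_discrete dcD.
have [||x y|x|t Xt tP] := @discrete_subgroup_cyclic R X (d / 4).
- by rewrite divr_gt0.
- by exists 1%g; rewrite ?gpred1// sgn1 tr1.
- move=> [g gD [gi <-]] [h hD [hi <-]]; exists (g * h^-1)%g.
    by rewrite gpredM ?gpredV.
  by rewrite sgnM// trM// sgnV tr_inv// gi hi; split; ring.
- move=> [g gD [gi <-]] gd.
  have [h hD [hs hi hj]] := axis_translation gD gi.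
  have h1 : h = 1%g.
    apply: Dd => // j; have [->|ji] := eqVneq j i; last by rewrite hj// normr0.
    by rewrite hi normrM ger0_norm//; lra.
  by move: hi; rewrite h1 tr1; lra.
have [[r [rD ri]]|none] := pselect (exists r, r \in D /\ sgn r i = - 1).
  exists (tr r i / 2), t; split => // g gD.
  have [gi|gi] := sgn_cases i gD.
    have [|m mE] := tP (tr g i); first by exists g.
    by exists m; rewrite gi mul1r mE.
  have [|m mE] := tP (tr g i - tr r i).
    exists (g * r)%g; first by rewrite gpredM.
    by rewrite sgnM// trM// gi ri; split; ring.
  by exists m; rewrite gi -mE; field.
exists 0, t; split => // g gD; have [|m mE] := tP (tr g i).
  by exists g => //; have [//|gi] := sgn_cases i gD; case: none; exists g.
by exists m; rewrite mulr0 !add0r.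
Qed.

End Crystal.
End Diagonal.

(** * Slices and Klein bottle subgroups *)

Lemma int_parity (m : int) : exists k : int, m = k + k \/ m = k + k + 1.
Proof. by exists (m %/ 2)%Z; lia. Qed.

Lemma neq1N1 (R : realFieldType) : (1 : R) <> - 1.
Proof. by move=> ?; lra. Qed.

Section MoreCrystal.
Variables (R : realType) (n : nat) (D : groupClosed (rigid R n)).
Hypothesis dcD : diagonal_crystal D.
Implicit Types g h : rigid R n.

Lemma sgn_zpow g (m : int) i : g \in D -> sgn g i = 1 -> sgn (zpow g m) i = 1.
Proof.
move=> gD gi; elim: m => [|m IH|m IH]; first exact: sgn1.
  by rewrite intS zpowS (sgnM dcD)// gi mul1r.
by rewrite intS opprD zpowP (sgnM dcD) ?gpredV// sgnV gi mul1r.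
Qed.

Lemma tr_zpow g (m : int) i : g \in D -> sgn g i = 1 ->
  tr (zpow g m) i = m%:~R * tr g i.
Proof.
move=> gD gi; elim: m => [|m IH|m IH]; first by rewrite tr1 mul0r.
  by rewrite intS zpowS (trM dcD)// gi intrD IH; ring.
rewrite intS opprD zpowP (trM dcD) ?gpredV// sgnV gi (tr_inv dcD)// gi intrD IH.
by ring.
Qed.

Lemma crystal_torsion_free g (k : nat) :
  g \in D -> (0 < k)%N -> (g ^+ k = 1)%g -> g = 1%g.
Proof.
move=> gD k0 gk; apply: (dc_free dcD) => // i gi.
have /eqP := tr_zpow k gD gi; rewrite /= gk tr1 eq_sym mulf_eq0.
by rewrite -pmulrn pnatr_eq0 eqn0Ngt k0 => /eqP.
Qed.

(** If the reflection in every single coordinate were a holonomy, then so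
    would be their product -1, which [dc_free] excludes. *)
Lemma free_axis : (0 < n)%N ->
  exists i, forall g, g \in D -> ~ (forall j, sgn g j = (- 1) ^+ (j == i)).
Proof.
move=> n0; apply: contrapT => none.
have flip i : exists2 g, g \in D & forall j, sgn g j = (- 1) ^+ (j == i).
  apply: contrapT => noflip; apply: none; exists i => g gD gi.
  by apply: noflip; exists g.
suff /(_ n (leqnn n))[g gD gs] : forall k, (k <= n)%N ->
    exists2 g, g \in D & forall j : 'I_n, sgn g j = (- 1) ^+ (j < k)%N.
  have := gs (Ordinal n0); rewrite (dc_free dcD gD).
    by rewrite sgn1 n0 expr1; lra.
  by move=> i; rewrite gs ltn_ord expr1 => ?; lra.
elim=> [_|k IH kn].
    by exists 1%g; rewrite ?gpred1// => j; rewrite sgn1.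
  have [g gD gs] := IH (ltnW kn); have [h hD hs] := flip (Ordinal kn).
  exists (g * h)%g => [|j]; first by rewrite gpredM.
  rewrite (sgnM dcD)// gs hs -val_eqE /= ltnS [(j <= k)%N]leq_eqVlt.
  have [jk|jk|jk] := ltngtP j k; rewrite /= ?expr0 ?expr1 ?mul1r ?mulr1//.
Qed.

End MoreCrystal.

Section Slice.
Variables (R : realType) (n : nat) (D : groupClosed (rigid R n.+1)).
Hypothesis dcD : diagonal_crystal D.
Hypothesis n0 : (0 < n)%N.
Variables (i : 'I_n.+1) (c t : R) (w : rigid R n.+1).
Hypothesis iD : forall g, g \in D -> ~ (forall j, sgn g j = (- 1) ^+ (j == i)).
Hypothesis cD : forall g, g \in D ->
  exists m : int, sgn g i * c + tr g i = c + m%:~R * t.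
Hypotheses (wD : w \in D) (wi : sgn w i = 1) (wt : tr w i = t).
Implicit Types (g : rigid R n.+1) (h : rigid R n).

(** The motion h of the hyperplane x_i = c is induced by the element g of its
    stabilizer. *)
Definition restricts g h : Prop :=
  [/\ g \in D, sgn g i * c + tr g i = c, diag_motion h &
      forall j, sgn h j = sgn g (lift i j) /\ tr h j = tr g (lift i j)].

Lemma restricts1 : restricts 1%g 1%g.
Proof.
split; rewrite ?gpred1 ?sgn1 ?tr1 ?mul1r ?addr0 ?diag_motion1// => j.
by rewrite !sgn1 !tr1.
Qed.

Lemma restrictsM g h g' h' :
  restricts g h -> restricts g' h' -> restricts (g * g')%g (h * h')%g.
Proof.
move=> [gD gc dh hg] [gD' gc' dh' hg']; split.
- by rewrite gpredM.
- by rewrite (sgnM dcD)// (trM dcD)// addrA -mulrA -mulrDr gc'.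
- exact: diag_motionM.
- move=> j; rewrite sgn_mul// tr_mul// (sgnM dcD)// (trM dcD)//.
  by have [-> ->] := hg j; have [-> ->] := hg' j.
Qed.

Lemma restrictsV g h : restricts g h -> restricts g^-1%g h^-1%g.
Proof.
move=> [gD gc dh hg]; split.
- by rewrite gpredV.
- have tE : tr g i = c - sgn g i * c by lra.
  by rewrite sgnV (tr_inv dcD)// tE mulrBr mulrA (sgnK dcD)//; ring.
- exact: diag_motionV.
- move=> j; rewrite !sgnV trV// (tr_inv dcD)//.
  by have [-> ->] := hg j.
Qed.

(** On the axis i, the element g fixes c; so if h moves no coordinate of sign 1
    then g has a fixed point. *)
Lemma restricts_free g h : restricts g h ->
  (forall j, sgn h j = 1 -> tr h j = 0) -> g = 1%g.
Proof.
move=> [gD gc dh hg] free; apply: (dc_free dcD) => // j.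
have [->|ji] := eqVneq j i; first by move=> gi; move: gc; rewrite gi; lra.
move: ji; rewrite eq_sym => /unlift_some[k -> _].
by have [<- <-] := hg k; exact: free.
Qed.

Lemma restricts_inj g g' h : restricts g h -> restricts g' h -> g = g'.
Proof.
move=> gh gh'; apply: divg1_eq.
apply: (restricts_free (restrictsM gh (restrictsV gh'))) => j _.
by rewrite mulgV tr1.
Qed.

Lemma restricts_fun g h h' : restricts g h -> restricts g h' -> h = h'.
Proof.
move=> [_ _ dh hg] [_ _ dh' hg']; apply: diag_motion_inj => // j;
  by have [? ?] := hg j; have [? ?] := hg' j; congruence.
Qed.

Lemma restricts_ex g : g \in D -> sgn g i * c + tr g i = c ->
  exists h, restricts g h.
Proof.
move=> gD gc; exists (sign_motion (fun j => sgn g (lift i j) == - 1)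
  (fun j => tr g (lift i j))); split=> //; first exact: sign_motion_diag.
move=> j; rewrite sgn_sign_motion tr_sign_motion; split=> //.
have [->|->] := sgn_cases dcD (lift i j) gD; last by rewrite eqxx expr1.
by rewrite (_ : (1 == - 1 :> R) = false) ?expr0//; apply/negbTE/eqP; lra.
Qed.

Definition slice : rigid R n -> bool := fun h => `[< exists g, restricts g h >].

Lemma slice_closed : group_closed slice.
Proof.
split=> [|h h' /asboolP[g gh] /asboolP[g' gh']]; apply/asboolP.
  by exists 1%g; exact: restricts1.
by exists (g * g'^-1)%g; apply: restrictsM => //; exact: restrictsV.
Qed.

Local Notation S := (pred_group slice_closed).

Lemma slice_embeds : monomorphic (subgroup S) (subgroup D).
Proof.
have ex (h : subgroup S) : exists g : subgroup D, restricts (\val g) (\val h).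
  have /asboolP[g gh] := valP h; have [gD _ _ _] := gh.
  by exists (Subgroup gD).
have [f fP] := choice ex.
have fM : {morph f : x y / (x * y)%g}.
  move=> x y; apply: val_inj; apply: restricts_inj (fP _) _.
  exact: restrictsM (fP x) (fP y).
exists (HB.pack_for {multiplicative _ -> _} f
  (isMultiplicative.Build _ _ f fM)).
move=> x y /= xy; apply: val_inj; have := fP y; rewrite -xy => fxy.
exact: restricts_fun (fP x) fxy.
Qed.

(** An element that moves c by an even multiple of t can be corrected by a power
    of the square of w, which is a translation, so that the holonomy is
    unchanged. *)
Lemma even_correction g (k : int) : g \in D ->
  sgn g i * c + tr g i = c + (k + k)%:~R * t ->
  exists g', [/\ g' \in D, sgn g' =1 sgn g & sgn g' i * c + tr g' i = c].
Proof.
move=> gD gk; have w2D : (w * w)%g \in D by rewrite gpredM.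
have sw2 j : sgn (w * w)%g j = 1 by rewrite (sgnM dcD)// (sgnK dcD).
pose v := zpow (w * w)%g (- k).
have vD : v \in D by rewrite gpred_zpow.
have sv j : sgn v j = 1 by rewrite (sgn_zpow dcD).
exists (v * g)%g; split; first by rewrite gpredM.
  by move=> j; rewrite (sgnM dcD)// sv mul1r.
rewrite (sgnM dcD)// (trM dcD)// sv !mul1r (tr_zpow dcD)// (trM dcD)// wi wt.
by rewrite addrA gk intrD intrN; ring.
Qed.

(** Extend s to the axis i by either sign.  Up to a global sign both extensions
    are holonomies, of elements g and g' that move c to the lattice c + tZ.  If
    one of them moves c by an even multiple of t, it can be corrected to fix
    c.  If both multiples are odd, then g g' can be corrected to fix c; but its
    holonomy is, up to a global sign, the reflection in the coordinate i.  The
    reflection itself is excluded by the choice of the axis i, and for its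
    opposite the corrected element has a fixed point. *)
Lemma slice_holonomy (s : 'I_n -> bool) : exists g, [/\ g \in D,
  sgn g i * c + tr g i = c &
  exists b, forall j, sgn g (lift i j) = (- 1) ^+ (s j (+) b)].
Proof.
pose ext b0 j := if unlift i j is Some k then s k else b0.
have ext_lift b0 k : ext b0 (lift i k) = s k by rewrite /ext liftK.
have exti b0 : ext b0 i = b0 by rewrite /ext unlift_none.
have corr g b0 b (k : int) : g \in D ->
    (forall j, sgn g j = (- 1) ^+ (ext b0 j (+) b)) ->
    sgn g i * c + tr g i = c + (k + k)%:~R * t ->
    exists g, [/\ g \in D, sgn g i * c + tr g i = c &
      exists b, forall j, sgn g (lift i j) = (- 1) ^+ (s j (+) b)].
  move=> gD gb /(even_correction gD)[g' [gD' gs gc]]; exists g'; split=> //.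
  by exists b => j; rewrite gs gb ext_lift.
have [g gD [b gb]] := dc_holonomy dcD (ext false).
have [g' gD' [b' gb']] := dc_holonomy dcD (ext true).
have [m mE] := cD gD; have [m' mE'] := cD gD'.
have [k [kE|kE]] := int_parity m; first by apply: corr gD gb _; rewrite mE kE.
have [k' [kE'|kE']] := int_parity m'.
  by apply: corr gD' gb' _; rewrite mE' kE'.
exfalso.
have ggD : (g * g')%g \in D by rewrite gpredM.
have [l lE] : exists l : int,
    sgn (g * g')%g i * c + tr (g * g')%g i = c + (l + l)%:~R * t.
  exists (if sgn g i == 1 then k + k' + 1 else k - k').
  rewrite (sgnM dcD)// (trM dcD)//.
  have -> : sgn g i * sgn g' i * c + (sgn g i * tr g' i + tr g i) =
    sgn g i * (sgn g' i * c + tr g' i) + tr g i by ring.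
  rewrite mE'; move: mE; rewrite kE kE'.
  have [->|->] := sgn_cases dcD i gD; first by rewrite eqxx !intrD => mE; lra.
  have -> : (- 1 == 1 :> R) = false by apply/negbTE/eqP; lra.
  by rewrite !intrD !intrN => mE; lra.
have [h [hD hs hc]] := even_correction ggD lE.
have sE j : sgn h j = if j == i then (- 1) ^+ (true (+) (b (+) b'))
    else (- 1) ^+ (b (+) b').
  rewrite hs (sgnM dcD)// gb gb' -signr_addb.
  have [->|ji] := eqVneq j i; first by rewrite !exti; case: b b' {gb gb'} => [] [].
  move: (ji); rewrite eq_sym => /unlift_some[k0 -> _].
  by rewrite !ext_lift; case: b b' (s k0) {gb gb'} => [] [] [].
case bb: (b (+) b') sE => sE.
  have h1 : h = 1%g.
    apply: (dc_free dcD) => // j; rewrite sE; have [->|_] := eqVneq j i.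
      by move=> _; move: hc; rewrite sE eqxx /= expr0; lra.
    by rewrite expr1 => ?; lra.
  have := sE (lift i (Ordinal n0)).
  by rewrite h1 sgn1 eq_sym (negbTE (neq_lift _ _)) expr1; lra.
by apply: (iD hD) => j; rewrite sE /=; case: eqP.
Qed.

Lemma slice_crystal : diagonal_crystal S.
Proof.
have S1 g h : restricts g h -> g = 1%g -> h = 1%g.
  by move=> gh g1; apply: restricts_fun gh _; rewrite g1; exact: restricts1.
split.
- by move=> h /asboolP[g []].
- move=> h /asboolP[g gh] free; apply: (S1 g) => //.
  exact: restricts_free gh free.
- have [d d0 Dd] := dc_discrete dcD; exists d => // h /asboolP[g gh] hs hd.
  apply: (S1 g) => //; have [gD gc _ hg] := gh.
  have gl k : sgn g (lift i k) = 1 by have [<- _] := hg k.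
  have gi : sgn g i = 1.
    have [//|gi] := sgn_cases dcD i gD; exfalso; apply: (iD gD) => j.
    have [->|] := eqVneq j i; first by rewrite gi expr1.
    by rewrite eq_sym => /unlift_some[k -> _]; rewrite gl.
  apply: Dd => // j; have [->|] := eqVneq j i.
  + by [].
  + by rewrite eq_sym => /unlift_some[k -> _].
  + by rewrite (_ : tr g i = 0) ?normr0//; move: gc; rewrite gi; lra.
  + by rewrite eq_sym => /unlift_some[k -> _]; have [_ <-] := hg k.
- move=> j; have [g gD [gs gj]] := dc_translation dcD (lift i j).
  have [h hD [hs hj h0]] := axis_translation dcD gD (gs (lift i j)).
  have [|h' hh'] := restricts_ex hD.
    by rewrite hs h0 ?mul1r ?addr0// neq_lift.
  have [_ _ _ h'h] := hh'; exists h'; first by apply/asboolP; exists h.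
  split; first by move=> k; have [-> _] := h'h k.
  by have [_ ->] := h'h j; rewrite hj mulf_neq0// pnatr_eq0.
- move=> s; have [g [gD gc [b gs]]] := slice_holonomy s.
  have [h gh] := restricts_ex gD gc; exists h; first by apply/asboolP; exists g.
  by exists b => j; have [_ _ _ hg] := gh; have [-> _] := hg j.
Qed.

End Slice.

Lemma crystal_slice (R : realType) (n : nat) (D : groupClosed (rigid R n.+1)) :
  (0 < n)%N -> diagonal_crystal D ->
  exists S : rigid R n -> bool, exists2 cS : group_closed S,
    diagonal_crystal (pred_group cS) &
    monomorphic (subgroup (pred_group cS)) (subgroup D).
Proof.
move=> n0 dcD; have [i iD] := free_axis dcD (ltn0Sn n).
have [c [t [cD [w wD [wi wt]]]]] := axis_cyclic dcD i.
exists (slice D i c), (slice_closed dcD i c).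
  exact: (@slice_crystal R n D dcD n0 i c t w iD cD wD wi wt).
exact: slice_embeds.
Qed.

Section KleinSubgroup.
Variables (R : realType) (n : nat) (D : groupClosed (rigid R n)).
Hypothesis dcD : diagonal_crystal D.

Lemma val_zpow (g : subgroup D) m : \val (zpow g m) = zpow (\val g) m.
Proof.
have vX k : \val (g ^+ k)%g = (\val g ^+ k)%g by rewrite gmulfXn.
by case: m => k; rewrite /zpow -?vX// gmulfV.
Qed.

Lemma subgroup_torsion_free (g : subgroup D) (k : nat) :
  (0 < k)%N -> (g ^+ k = 1)%g -> g = 1%g.
Proof.
move=> k0 gk; apply: val_inj; apply: (crystal_torsion_free dcD (valP g) k0).
by rewrite -gmulfXn gk.
Qed.

Lemma reflected_translation (g b : rigid R n) : g \in D -> b \in D ->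
  (forall i, sgn b i = 1) -> (forall i, sgn g i = 1 -> tr b i = 0) ->
  (b ^ g = b^-1)%g.
Proof.
move=> gD bD sb tb.
have dg := dc_diagonal dcD gD; have db := dc_diagonal dcD bD.
apply: diag_motion_inj => [||i|i].
- by rewrite conjgE !diag_motionM ?diag_motionV.
- exact: diag_motionV.
- by rewrite conjgE !sgn_mul ?diag_motionV// !sgnV sb mul1r sgn_sqr.
- rewrite conjgE !tr_mul ?diag_motionV// !trV// sgnV sb mul1r.
  have [gi|gi] := sgnP i dg; last by rewrite gi; ring.
  by rewrite tb// gi; ring.
Qed.

Lemma klein_morphism (a b : rigid R n) : a \in D -> b \in D ->
  (b ^ a = b^-1)%g -> a != 1%g -> b != 1%g ->
  exists2 f : {multiplicative klein_deck -> subgroup D}, injective f &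
  forall m k : int, \val (f (m, k)) = (zpow b k * zpow a m)%g.
Proof.
move=> aD bD ab a1 b1; pose a' := Subgroup aD; pose b' := Subgroup bD.
have ab' : (b' ^ a' = b'^-1)%g by exact: val_inj.
exists (HB.pack_for {multiplicative klein_deck -> subgroup D} (klein_map a' b')
  (isMultiplicative.Build _ _ (klein_map a' b') (klein_mapM ab'))).
  apply: (klein_map_inj ab' subgroup_torsion_free).
    by apply: contraNneq a1 => /(congr1 val) /= ->.
  by apply: contraNneq b1 => /(congr1 val) /= ->.
move=> m k; apply: etrans (valM _ _) _.
exact: congr2 (val_zpow b' k) (val_zpow a' m).
Qed.

(** The sign vector that is -1 at one coordinate only, and its opposite, both
    reverse some axis when n >= 2. *)
Lemma klein_embeds : (2 <= n)%N -> monomorphic klein_deck (subgroup D).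
Proof.
move=> n2; pose i0 := Ordinal (ltnW n2); pose i1 := Ordinal n2.
have [a aD [b ab]] := dc_holonomy dcD (fun j => j == i0).
have [i ai] : exists i, sgn a i = - 1.
  case: b ab => ab; first by exists i1; rewrite ab expr1.
  by exists i0; rewrite ab eqxx expr1.
have [g gD [gs gi]] := dc_translation dcD i.
have [h hD [hs hi hj]] := axis_translation dcD gD (gs i).
have [|||f fi _] := klein_morphism aD hD.
- apply: reflected_translation => // j aj; apply: hj.
  by apply/eqP => ji; move: aj; rewrite ji ai; lra.
- by apply/eqP => a1; move: ai; rewrite a1 sgn1; lra.
- apply: contraNneq gi => h1; move: hi; rewrite h1 tr1 => ?.
  by apply/eqP; lra.
by exists f.
Qed.

End KleinSubgroup.

(** No element reverses the axis i of [free_axis]: otherwise its holonomy would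
    be the reflection in i or -1.  So the group maps to a cyclic group of translations
    of this axis, generated by the image of some w.  The kernel consists of
    translations along the other axis j, since an element reversing j and
    fixing i pointwise has a fixed point; it is generated by one element b.
    Some element reverses j, and only w can be responsible for it, so w
    inverts b. *)
Lemma klein_surface (R : realType) (D : groupClosed (rigid R 2)) :
  diagonal_crystal D ->
  isomorphic klein_deck (subgroup D).
Proof.
move=> dcD; have [i iD] := free_axis dcD (isT : 0 < 2)%N.
have [c [t [cD [w wD [wi wt]]]]] := axis_cyclic dcD i.
pose j := lift i (ord0 : 'I_1).
have ijP k : k = i \/ k = j.
  have [->|] := eqVneq k i; [by left|rewrite eq_sym => /unlift_some[l -> _]].
  by right; rewrite /j (ord1 l).
have ij : j == i = false by rewrite eq_sym (negbTE (neq_lift _ _)).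
have si g : g \in D -> sgn g i = 1.
  move=> gD; have [//|gi] := sgn_cases dcD i gD; exfalso.
  have [gj|gj] := sgn_cases dcD j gD.
    by apply: (iD _ gD) => k; have [->|->] := ijP k;
      rewrite ?gi ?gj ?eqxx ?ij ?expr0 ?expr1.
  move: (gi); rewrite (dc_free dcD gD) ?sgn1 => [/neq1N1|k]//.
  by have [->|->] := ijP k; rewrite ?gi ?gj => ?; lra.
have sj g : g \in D -> tr g i = 0 -> sgn g j = 1.
  move=> gD gi; have [//|gj] := sgn_cases dcD j gD.
  rewrite (dc_free dcD gD) ?sgn1// => k.
  by have [->|->] := ijP k; rewrite ?gi ?gj => // ?; lra.
pose X x := exists2 g, g \in D & tr g i = 0 /\ tr g j = x.
have [d d0 Dd] := dc_discrete dcD.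
have [|x y|x|t' [b bD [bi bj]] Xt'] := @discrete_subgroup_cyclic R X d d0.
- by exists 1%g; rewrite ?gpred1 ?tr1.
- move=> [g gD [gi <-]] [h hD [hi <-]]; exists (g * h^-1)%g.
    by rewrite gpredM ?gpredV.
  rewrite !(trM dcD)// !(tr_inv dcD)// gi hi !si// !sj//; split; ring.
- move=> [g gD [gi <-]] gd; suff -> : g = 1%g by rewrite tr1.
  by apply: Dd => // k; have [->|->] := ijP k; rewrite ?si ?sj ?gi ?normr0.
have gen g : g \in D -> exists m k : int, g = (zpow w m * zpow b k)%g.
  move=> gD; have [m mE] := cD g gD.
  have gi : tr g i = m%:~R * t by move: mE; rewrite si// mul1r; lra.
  have wm := gpred_zpow m wD.
  have g'D : (zpow w (- m) * g)%g \in D by rewrite gpredM ?gpred_zpow.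
  have g'i : tr (zpow w (- m) * g)%g i = 0.
    rewrite (trM dcD) ?gpred_zpow// si ?gpred_zpow// (tr_zpow dcD)// wt gi intrN.
    by ring.
  have [|k kE] := Xt' (tr (zpow w (- m) * g)%g j).
    by exists (zpow w (- m) * g)%g.
  exists m, k; rewrite -[g](mulVKg (zpow w m)) -zpowN; congr (_ * _)%g.
  have bk := gpred_zpow k bD.
  apply: diag_motion_inj; rewrite ?(dc_diagonal dcD)// => l.
    have [->|->] := ijP l; first by rewrite !si.
    by rewrite !sj// (tr_zpow dcD) ?si// bi mulr0.
  have [->|->] := ijP l; rewrite (tr_zpow dcD) ?si ?sj//.
    by rewrite g'i bi mulr0.
  by rewrite kE bj.
have wj : sgn w j = - 1.
  have [wj|//] := sgn_cases dcD j wD.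
  have [g gD [e ge]] := dc_holonomy dcD (fun k => k == j).
  have e0 : e = false.
    have := ge i; rewrite si// eq_sym ij; case: e {ge} => //=.
    by rewrite expr1; lra.
  have := ge j; rewrite eqxx e0 expr1; have [m [k ->]] := gen g gD.
  rewrite (sgnM dcD) ?gpred_zpow// !(sgn_zpow dcD) ?wj ?(sj b)//.
  by rewrite mul1r => /neq1N1.
have bw : (b ^ w = b^-1)%g.
  apply: (reflected_translation dcD) => // k.
    by have [->|->] := ijP k; rewrite ?si ?sj.
  by have [->|->] := ijP k; rewrite ?wj => // ?; lra.
have w1 : w != 1%g by apply/eqP => w1; move: wj; rewrite w1 sgn1; lra.
have b1 : b != 1%g.
  have [g gD [gs gj]] := dc_translation dcD j.
  have [h hD [hs hj hi]] := axis_translation dcD gD (gs j).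
  have [|m mE] := Xt' (tr h j).
    by exists h => //; rewrite hi// eq_sym ij.
  apply: contraNneq gj => b1; move: mE; rewrite hj -bj b1 tr1 mulr0 => ?.
  by apply/eqP; lra.
have [f fi fE] := klein_morphism dcD wD bD bw w1 b1.
exists f; have fsurj (g : subgroup D) : exists x, f x = g.
  have [m [k gE]] := gen _ (valP g).
  exists (m, (- 1) ^ m * k); apply: val_inj; rewrite fE gE.
  by rewrite (zpow_conj_klein bw).
have [f' f'K] := choice fsurj; exists f' => // x.
by apply: fi; rewrite f'K.
Qed.

(** * A diagonal group is a generalized Hantzsche-Wendt group *)

Lemma mx_continuous (T U : topologicalType) (m n : nat) (f : T -> 'M[U]_(m, n)) :
  (forall i j, continuous (fun t => f t i j)) -> continuous f.
Proof.
move=> cf t A [P Pt PA]; apply: (filterS PA).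
apply: filter_forall => i; apply: filter_forall => j; exact: (cf i j t _ (Pt i j)).
Qed.

Lemma mx_box_compact (R : realType) (m n : nat) (C : R) :
  compact [set A : 'M[R]_(m, n) | forall i j, `|A i j| <= C].
Proof.
have cB : compact [set v : 'rV[R]_(m * n) |
    forall i, (`[- C, C]%classic : set R) (v ord0 i)].
  apply: (@rV_compact R _ (fun=> `[- C, C]%classic)) => _.
  exact: segment_compact.
rewrite (_ : [set A | _] = vec_mx @` [set v : 'rV[R]_(m * n) |
    forall i, (`[- C, C]%classic : set R) (v ord0 i)]); last first.
  apply/seteqP; split=> [A AC|_ [v vC <-] i j]; last first.
    by rewrite mxE ler_norml; have := vC (mxvec_index i j); rewrite /= in_itv.
  exists (mxvec A); last exact: mxvecK.
  move=> k; case/mxvec_indexP: k => i j.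
  by rewrite /= in_itv /= mxvecE -ler_norml.
apply: continuous_compact => //; apply: continuous_subspaceT.
apply: mx_continuous => i j; under eq_fun do rewrite mxE.
exact: coord_continuous.
Qed.

(** A cluster point of the image filter is the image of a cluster point, because
    the neighbourhoods in the initial topology are preimages. *)
Lemma initial_compact (S : choiceType) (T : topologicalType) (f : S -> T)
    (K : set T) : K `<=` range f -> compact K ->
  compact (f @^-1` K : set (initial_topology f)).
Proof.
move=> Kf cK F FF FK.
have [|p [Kp clp]] := cK (f @ F) _; first by [].
have [g _ gp] := Kf _ Kp; exists g; split; first by rewrite /= gp.
move=> A B FA [_ [[U oU <-] Ug UB]].
have [||_ [[x Ax <-] Ux]] := clp (f @` A) U.
- by rewrite /=; apply: filterS FA; exact: preimage_image.
- by rewrite -gp; exact: open_nbhs_nbhs.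
- by exists x; split=> //; exact: UB.
Qed.

Lemma orthogonal_entry (R : realType) (n : nat) (A : 'M[R]_n) i j :
  A^T *m A = 1%:M -> `|A i j| <= 1.
Proof.
move=> OA; rewrite -(@expr_le1 _ 2)// real_normK ?num_real//.
have := congr1 (fun B : 'M[R]_n => B j j) OA; rewrite !mxE eqxx mulr1n => <-.
rewrite (bigD1 i)//= mxE -expr2 lerDl; apply: sumr_ge0 => k _.
by rewrite mxE -expr2 sqr_ge0.
Qed.

Lemma rigid_box_compact (R : realType) (n : nat) (C : R) :
  compact [set g : rigid R n | forall i, `|tr g i| <= C].
Proof.
pose O := [set A : 'M[R]_n | A^T *m A = 1%:M].
have cO : closed O.
  rewrite (_ : O = (fun A : 'M[R]_n => A^T *m A) @^-1` [set 1%:M]); last by [].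
  apply: preimage_closed; last first.
    exact/accessible_closed_set1/hausdorff_accessible/norm_hausdorff.
  move=> A _; apply: mx_continuous => i j.
  rewrite (_ : (fun _ => _) =
    (fun B : 'M[R]_n => \sum_k B^T i k * B k j)); last first.
    by apply/funext => B; rewrite mxE.
  apply: (@continuous_big _ _ +%R); first exact: add_continuous.
  move=> k _ A1.
  have ct : continuous (fun B : 'M[R]_n => B^T i k).
    rewrite (_ : (fun _ => _) = (fun B : 'M[R]_n => B k i)).
      exact: coord_continuous.
    by apply/funext => B; rewrite mxE.
  by apply: continuousM; [exact: ct|exact: coord_continuous].
have Obox A : O A -> forall i j, `|A i j| <= 1.
  by move=> OA i j; exact: orthogonal_entry.
pose K := O `*` [set a : 'cV[R]_n | forall i j, `|a i j| <= C].
have cK : compact K.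
  apply: compact_setX; last exact: mx_box_compact.
  by apply: subclosed_compact cO (@mx_box_compact R n n 1) _ => A /Obox.
rewrite (_ : [set g | _] = @rigid_pair R n @^-1` K).
  apply: initial_compact => // -[A a] [/eqP OA _].
  by exists (Rigid a OA).
apply/seteqP; split=> [g gC|g [_ gC] i]; last exact: gC.
split; first exact/eqP/linear_part_orthogonal.
by move=> i j; rewrite (ord1 j); exact: gC.
Qed.

Lemma linear_part_continuous (R : realType) (n : nat) i j :
  continuous (fun g : rigid R n => linear_part g i j).
Proof.
move=> g; apply: (@continuous_comp (rigid R n) ('M[R]_n * 'cV[R]_n)%type R
    (@rigid_pair R n) (fun p => p.1 i j)).
  exact: initial_continuous.
apply: (@continuous_comp _ _ R fst (fun A : 'M[R]_n => A i j)).
  exact: cvg_fst.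
exact: coord_continuous.
Qed.

Lemma tr_continuous (R : realType) (n : nat) i :
  continuous (fun g : rigid R n => tr g i).
Proof.
move=> g; apply: (@continuous_comp (rigid R n) ('M[R]_n * 'cV[R]_n)%type R
    (@rigid_pair R n) (fun p => p.2 i 0)).
  exact: initial_continuous.
apply: (@continuous_comp _ _ R snd (fun a : 'cV[R]_n => a i 0)).
  exact: cvg_snd.
exact: coord_continuous.
Qed.

Lemma continuous_sumR (R : realType) (T : topologicalType) (n : nat)
    (f : 'I_n -> T -> R) : (forall j, continuous (f j)) ->
  continuous (fun x => \sum_j f j x).
Proof.
move=> cf; apply: (@continuous_big _ _ +%R); first exact: add_continuous.
by move=> j _; exact: cf.
Qed.

Lemma continuous_mulR (R : realType) (T : topologicalType) (f g : T -> R) :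
  continuous f -> continuous g -> continuous (fun x => f x * g x).
Proof. by move=> cf cg x; apply: cvgM; [exact: cf|exact: cg]. Qed.

Lemma continuous_addR (R : realType) (T : topologicalType) (f g : T -> R) :
  continuous f -> continuous g -> continuous (fun x => f x + g x).
Proof. by move=> cf cg x; apply: cvgD; [exact: cf|exact: cg]. Qed.

Lemma continuous_oppR (R : realType) (T : topologicalType) (f : T -> R) :
  continuous f -> continuous (fun x => - f x).
Proof. by move=> cf x; apply: cvgN; exact: cf. Qed.

Lemma pi_translations (R : realType) (n : nat) (Gamma : groupClosed (rigid R n))
    (x y : subgroup Gamma) :
  \pi_(coset_space (@translations R n Gamma)) x =
  \pi_(coset_space (@translations R n Gamma)) y <->
  linear_part (\val x) = linear_part (\val y).
Proof.
split=> [/pi_eqP|xy].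
  rewrite inE /= => /eqP xy1.
  by rewrite -[RHS]mul1mx -(rigid_linear_trmx (\val x)) -mulmxA xy1 mulmx1.
apply/pi_eqP; rewrite inE /= xy.
exact: linear_part_orthogonal.
Qed.

Lemma nearest_multiple (R : realType) (c u : R) : c != 0 ->
  exists m : int, `|m%:~R * c + u| <= `|c|.
Proof.
move=> c0.
exists (- Num.floor (u / c)); rewrite intrN.
have /andP[f1 f2] := floor_itv (u / c).
have -> : - (Num.floor (u / c))%:~R * c + u = (u / c - (Num.floor (u / c))%:~R) * c.
  by field.
rewrite normrM ler_piMl// ger0_norm ?subr_ge0//.
by move: f2; rewrite intrD; lra.
Qed.

Section CrystalGHW.
Variables (R : realType) (n : nat) (D : groupClosed (rigid R n)).
Hypothesis dcD : diagonal_crystal D.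

(** Nearby elements have the same signs, so their quotient is a short
    translation. *)
Lemma crystal_discrete : discrete D.
Proof.
have [d d0 Dd] := dc_discrete dcD.
move=> g gD; split; first exact/mem_set.
have near i : \forall h \near g, `|sgn g i - sgn h i| < 1 /\ `|tr g i - tr h i| < d.
  apply: filterI.
    by have /cvgrPdist_lt := @linear_part_continuous R n i i g; apply.
  by have /cvgrPdist_lt := @tr_continuous R n i g; apply.
exists [set h | forall i, `|sgn g i - sgn h i| < 1 /\ `|tr g i - tr h i| < d].
  exact: (@filter_forall _ _ _ (nbhs g) _ near).
apply/seteqP; split=> [h [gh hD]|_ ->]; last first.
  by split=> // i; rewrite !subrr normr0.
have sE i : sgn h i = sgn g i.
  have [+ _] := gh i; have [->|->] := sgn_cases dcD i gD;
    have [->|->] := sgn_cases dcD i hD => //; rewrite ?opprK.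
    by rewrite ger0_norm; lra.
  by rewrite ler0_norm; lra.
suff gh1 : (g^-1 * h)%g = 1%g by rewrite -[h](mulVKg g) gh1 mulg1.
apply: Dd => [|i|i]; first by rewrite gpredM ?gpredV.
  by rewrite (sgnM dcD) ?gpredV// sgnV sE (sgnK dcD).
rewrite (trM dcD) ?gpredV// sgnV (tr_inv dcD)// -mulrBr normrM distrC.
have [_ ghi] := gh i; apply: le_lt_trans ghi; rewrite ler_piMl//.
by have [->|->] := sgn_cases dcD i gD; rewrite ?normrN normr1.
Qed.

(** The coordinates are reduced one after the other by translations along the
    axes. *)
Lemma crystal_lattice : exists c : 'I_n -> R, forall u : 'I_n -> R,
  exists2 g, g \in D & (forall i, sgn g i = 1) /\ forall i, `|tr g i + u i| <= c i.
Proof.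
have ax i : exists h, [/\ h \in D, forall j, sgn h j = 1, tr h i != 0 &
    forall j, j != i -> tr h j = 0].
  have [g gD [gs gi]] := dc_translation dcD i.
  have [h hD [hs hi hj]] := axis_translation dcD gD (gs i); exists h; split=> //.
  by rewrite hi mulf_neq0// pnatr_eq0.
have [h hP] := choice ax.
exists (fun i => `|tr (h i) i|) => u.
suff /(_ n (leqnn n)) [g gD [gs gu]] : forall k, (k <= n)%N ->
    exists2 g, g \in D & (forall i, sgn g i = 1) /\
      forall i : 'I_n, (i < k)%N -> `|tr g i + u i| <= `|tr (h i) i|.
  by exists g => //; split=> // i; exact: gu.
elim=> [_|k IH kn].
  by exists 1%g; rewrite ?gpred1//; split=> // i; rewrite sgn1.
have [g gD [gs gu]] := IH (ltnW kn); pose i := Ordinal kn.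
have [hD hs hi hj] := hP i.
have [m mP] := nearest_multiple (tr g i + u i) hi.
have hmD : zpow (h i) m \in D by exact: gpred_zpow.
exists (zpow (h i) m * g)%g; first by rewrite gpredM.
split=> j; first by rewrite (sgnM dcD)// (sgn_zpow dcD)// gs mul1r.
rewrite (trM dcD)// (sgn_zpow dcD)// mul1r (tr_zpow dcD)//.
have [->|ji] := eqVneq j i; first by rewrite (addrC (tr g i)) -addrA.
rewrite hj// mulr0 addr0 ltnS leq_eqVlt => /orP[/eqP jk|]; last exact: gu.
by move: ji; rewrite -val_eqE /= jk eqxx.
Qed.

(** By right multiplication by lattice translations, every motion can be brought
    to one with bounded translation part. *)
Lemma crystal_cocompact : cocompact D.
Proof.
have [c cP] := crystal_lattice.
pose K := [set g : rigid R n | forall i, `|tr g i| <= \sum_j c j].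
rewrite /cocompact (_ : [set: _] =
    (\pi_(coset_space D) : rigid R n -> quotient_topology _) @` K).
  apply: continuous_compact; last exact: rigid_box_compact.
  exact/continuous_subspaceT/pi_continuous.
apply/seteqP; split=> // x _; pose g := repr x.
have [h hD [hs hu]] := cP (fun i => ((linear_part g)^T *m translation_part g) i 0).
exists (g * h)%g; last first.
  rewrite -[RHS]reprK; apply/eqmodP.
  by rewrite /= /coset_rel /= invgM mulgVK gpredV.
move=> i.
rewrite /tr /=.
have -> : linear_part g *m translation_part h + translation_part g =
  linear_part g *m (translation_part h + (linear_part g)^T *m translation_part g).
  by rewrite mulmxDr mulmxA rigid_linear_trmx mul1mx.
rewrite mxE; apply: le_trans (ler_norm_sum _ _ _) _; apply: ler_sum => j _.
rewrite normrM; apply: le_trans (hu j).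
rewrite [in leLHS]mxE ler_piMl//.
exact/orthogonal_entry/eqP/linear_part_orthogonal.
Qed.

End CrystalGHW.

(** The holonomies form a complement of {1, -1} in the group of all sign
    vectors, so the ratios of the signs to the first one classify them. *)
Lemma crystal_holonomy (R : realType) (n : nat) (D : groupClosed (rigid R n.+1)) :
  diagonal_crystal D ->
  exists2 f : holonomy D -> 'rV['Z_2]_n,
    {morph f : x y / (x * y)%g >-> x + y} & bijective f.
Proof.
move=> dcD.
pose bit (g : rigid R n.+1) i := sgn g i == - 1 :> R.
have bitE g i : g \in D -> sgn g i = (- 1) ^+ bit g i.
  move=> gD; rewrite /bit; have [->|->] := sgn_cases dcD i gD.
    by rewrite (_ : (1 == - 1 :> R) = false)//; apply/negbTE/eqP/neq1N1.
  by rewrite eqxx expr1.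
have bitM g h i : g \in D -> h \in D -> bit (g * h)%g i = bit g i (+) bit h i.
  move=> gD hD; apply: (@signr_inj R).
  by rewrite signr_addb -!bitE ?gpredM// (sgnM dcD).
pose row (g : rigid R n.+1) : 'rV['Z_2]_n :=
  \row_j ((bit g (lift ord0 j) (+) bit g ord0)%:R).
have rowM g h : g \in D -> h \in D -> row (g * h)%g = row g + row h.
  move=> gD hD; apply/rowP => j; rewrite !mxE !bitM//.
  by apply: val_inj; case: (bit g _) (bit g _) (bit h _) (bit h _) => [] [] [] [].
have row0 g : g \in D -> row g = 0 -> linear_part g = 1%:M.
  move=> gD g0.
  have gb i : bit g i = bit g ord0.
    have [->//|] := eqVneq i ord0; rewrite eq_sym => /unlift_some[j -> _].
    have /rowP/(_ j) := g0; rewrite !mxE => /eqP.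
    by case: (bit g _) (bit g _) => [] [].
  rewrite (linear_diag_motion (dc_diagonal dcD gD)) -diag_const_mx.
  congr diag_mx; apply/rowP => i; rewrite !mxE bitE// gb.
  case g00 : (bit g ord0) => //.
  have g1 : g = 1%g.
    by apply: (dc_free dcD) => // j; rewrite bitE// gb g00 expr1 => /esym/neq1N1.
  by move: g00; rewrite /bit g1 sgn1 => /eqP/neq1N1.
pose f (x : holonomy D) : 'rV['Z_2]_n := row (\val (repr x)).
have fpi (x : subgroup D) :
    f (\pi_(coset_space (@translations R n.+1 D)) x) = row (\val x).
  rewrite /f /row /bit /sgn; set y := repr _.
  have /pi_translations -> // : \pi_(coset_space (@translations R n.+1 D)) y =
    \pi_(coset_space (@translations R n.+1 D)) x by rewrite reprK.
have fM : {morph f : x y / (x * y)%g >-> x + y}.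
  move=> x y; rewrite (_ : (x * y)%g =
    \pi_(coset_space (@translations R n.+1 D)) (repr x * repr y)%g)//.
  by rewrite fpi [LHS]rowM//; exact: valP.
exists f => //.
have finj : injective f.
  move=> x y xy; rewrite -[x]reprK -[y]reprK.
  apply/pi_eqP; rewrite inE; apply/eqP; apply: row0; first exact: valP.
  have -> : row (\val ((repr x)^-1 * repr y)%g) =
      row (\val (repr x)) + row (\val (repr y)).
    rewrite [LHS]rowM; [|by rewrite gpredV; exact: valP|exact: valP].
    by congr (_ + _); apply/rowP => j; rewrite !mxE /bit !sgnV.
  rewrite -/(f x) -/(f y) xy; apply/rowP => j; rewrite !mxE.
  by apply: val_inj; case: (_ (+) _).
have fsurj (v : 'rV['Z_2]_n) : exists x, f x = v.
  have [g gD [b gb]] := dc_holonomy dcD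
    (fun i => if unlift ord0 i is Some j then v 0 j == 1 else false).
  exists (\pi_(coset_space (@translations R n.+1 D)) (Subgroup gD)).
  rewrite fpi; apply/rowP => j; rewrite !mxE /=.
  have bE i : bit g i =
      (if unlift ord0 i is Some j then v 0 j == 1 else false) (+) b.
    by apply: (@signr_inj R); rewrite -bitE// gb.
  rewrite !bE liftK unlift_none addFb -addbA addbb addbF.
  by case: (v 0 j) => -[|[|]] //= k; apply: val_inj.
have [f' f'K] := choice fsurj; exists f' => // x.
by apply: finj; rewrite f'K.
Qed.

Lemma crystal_GHW (R : realType) (n : nat) (D : groupClosed (rigid R n.+1)) :
  diagonal_crystal D -> GHW D.
Proof.
move=> dcD; split; last exact: crystal_holonomy.
split; [|exact: crystal_discrete|exact: crystal_cocompact].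
by move=> g k; exact: crystal_torsion_free.
Qed.

(** * A generalized Hantzsche-Wendt group is diagonal in some basis *)

Lemma involution_diagonalizable (R : realFieldType) (n : nat) (A : 'M[R]_n.+1) :
  A *m A = 1%:M -> diagonalizable A.
Proof.
move=> AA; apply/diagonalizableP; exists [:: 1; - 1].
  by rewrite /= inE andbT; apply/eqP/neq1N1.
rewrite !big_cons big_nil mulr1; apply: mxminpoly_min.
rewrite rmorphM !rmorphB /= horner_mx_X !horner_mx_C.
rewrite raddfN /= opprK mulrBl mulrDr [A * A]AA.
by rewrite mulr1 mul1r [A + _]addrC subrr.
Qed.

Section Holonomy.
Variables (R : realType) (n : nat) (Gamma : groupClosed (rigid R n)).

(** The sets V k of cosets g Gamma for which the orbit under Gamma of the point
    g^-1 0 meets the cube of radius k are open, increase with k and cover the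
    quotient, so one of them is everything; g is then taken to be the
    translation by -u. *)
Lemma cocompact_bounded_orbit : cocompact Gamma ->
  exists C : R, forall u : 'cV[R]_n, exists2 g, g \in Gamma &
    forall i, `|(linear_part g *m u + translation_part g) i 0| <= C.
Proof.
move=> /compact_near_coveringP cG.
pose Q := quotient_topology (coset_space Gamma).
pose V (k : R) : set Q := [set q | exists2 g, g \in Gamma &
  forall i, `|tr (repr q * g)^-1%g i| < k].
have trV_continuous (h : rigid R n) i :
    continuous (fun g : rigid R n => tr (g * h)^-1%g i).
  pose T (g : rigid R n) : R := \sum_j linear_part (h^-1)%g i j *
    (- \sum_k (linear_part g k j * tr g k)).
  rewrite (_ : (fun _ => _) = fun g => T g + tr h^-1%g i); last first.
    apply/funext => g; rewrite invgM /tr /T [LHS]mxE; congr (_ + _).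
    rewrite [LHS]mxE; apply: eq_bigr => j _; congr (_ * _).
    rewrite [LHS]mxE; congr (- _).
    by rewrite [LHS]mxE; apply: eq_bigr => k _; rewrite [X in X * _]mxE.
  have cS j : continuous (fun g : rigid R n => \sum_k linear_part g k j * tr g k).
    apply: continuous_sumR => k.
    by apply: continuous_mulR; [exact: linear_part_continuous|exact: tr_continuous].
  have cT : continuous T.
    apply: continuous_sumR => j.
    apply: continuous_mulR; first exact: cst_continuous.
    exact/continuous_oppR/cS.
  by apply: continuous_addR; [exact: cT|exact: cst_continuous].
have repr_pi (g : rigid R n) : ((repr (\pi_Q g))^-1 * g)%g \in Gamma.
  have /eqmodP : \pi_(coset_space Gamma) (repr (\pi_Q g)) =
    \pi_(coset_space Gamma) g by rewrite reprK.
  by [].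
have oV k : open (V k).
  rewrite /open /= /quotient_open (_ : _ @^-1` _ = \bigcup_(h in [set` Gamma])
    [set g : rigid R n | forall i, `|tr (g * h)^-1%g i| < k]).
    apply: bigcup_open => h _; rewrite openE => g /= gk.
    have near i : \forall g' \near g, `|tr (g' * h)^-1%g i| < k.
      have /(trV_continuous h i g) near0 :
          nbhs (tr (g * h)^-1%g i) (ball (0 : R) k).
        apply: open_nbhs_nbhs; split; first exact: ball_open.
        by rewrite -ball_normE /= sub0r normrN.
      apply: (@filterS _ (nbhs g) _ _ _ _ near0) => g' /=.
      by rewrite -ball_normE /= sub0r normrN.
    exact: (@filter_forall _ _ _ (nbhs g) _ near).
  apply/seteqP; split=> [g [h hG gh]|g [h hG gh]].
    exists ((g^-1 * repr (\pi_Q g)) * h)%g.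
      rewrite /= gpredM// -gpredV invgM invgK; exact: repr_pi.
    by move=> i; rewrite mulgA mulVKg.
  exists ((repr (\pi_Q g))^-1 * g * h)%g; first by rewrite gpredM.
  by move=> i; rewrite !mulgA mulgV mul1g.
have [C CV] : exists C, setT `<=` V C.
  have : \forall k \near +oo, setT `<=` V k.
    apply: cG => q _; have [C qC] : exists C, V C q.
      exists (\sum_i `|tr (repr q * 1)^-1%g i| + 1).
      exists 1%g; rewrite ?gpred1// => i.
      rewrite (bigD1 i)//= -addrA ltrDl; apply: ltr_wpDl; last exact: ltr01.
      by apply: sumr_ge0.
    exists (V C, [set k | C < k]).
      split; first by apply: open_nbhs_nbhs; split; [exact: oV|].
      by apply: nbhs_pinfty_gt; exact: num_real.
    move=> [q' k] /= [[g gG gC] Ck]; exists g => // i.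
    exact: lt_trans (gC i) Ck.
  by move=> /filter_ex.
exists C => u.
have ou : (1%:M : 'M[R]_n)^T *m 1%:M == 1%:M by rewrite trmx1 mulmx1.
pose m := Rigid u ou.
have [g gG gC] := CV (\pi_Q m^-1%g) I.
move: (repr _) (repr_pi m^-1%g) gC => r rG gC.
exists ((r * g)^-1 * m^-1)%g.
  by rewrite invgM -mulgA gpredM ?gpredV.
move=> i; apply: ltW; have := gC i.
by rewrite -[X in tr X i](mulgVK m) {1}/tr.
Qed.

(** In the topology of the group of motions, a translation is close to the
    identity when its vector is short. *)
Lemma discrete_translations : discrete Gamma ->
  exists2 e : R, 0 < e & forall g, g \in Gamma -> linear_part g = 1%:M ->
    (forall i, `|tr g i| < e) -> g = 1%g.
Proof.
move=> /(_ 1%g gpred1)[_ [V [_ [[U oU <-] U1 UV]] VG]].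
have /nbhs_ballP[e /= e0 eU] : nbhs (@rigid_pair R n 1%g) U.
  exact: open_nbhs_nbhs.
exists e => // g gG g1 ge.
suff : [set (1%g : rigid R n)] g by [].
rewrite -VG; split=> //; apply: UV; apply: eU; split.
  by rewrite /= g1; exact: ballxx.
split=> // i j; rewrite (ord1 j) /= mxE.
by rewrite -ball_normE /= sub0r normrN; exact: ge.
Qed.

Variable F : holonomy Gamma -> 'rV['Z_2]_n.-1.
Hypotheses (FM : {morph F : x y / (x * y)%g >-> x + y}) (Fbij : bijective F).

Definition hol (x : subgroup Gamma) : 'rV['Z_2]_n.-1 :=
  F (\pi_(coset_space (@translations R n Gamma)) x).

Lemma holM x y : hol (x * y)%g = hol x + hol y.
Proof.
rewrite /hol -FM; congr F.
exact/esym/(qmulE (@translations_normal R n Gamma)).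
Qed.

(** The kernel of the projection to the holonomy group consists of the
    translations. *)
Lemma hol_eq x y : hol x = hol y <-> linear_part (\val x) = linear_part (\val y).
Proof.
rewrite -pi_translations; split=> xy; last first.
  exact: (congr1 (fun z : coset_space (@translations R n Gamma) => F z) xy).
exact: (bij_inj Fbij).
Qed.

Lemma hol_surj v : exists x, hol x = v.
Proof.
have [G _ GK] := Fbij; exists (repr (G v)).
by rewrite /hol reprK GK.
Qed.

Lemma Z2_addvv (m : nat) (v : 'rV['Z_2]_m) : v + v = 0.
Proof.
by apply/rowP => j; rewrite !mxE; apply: val_inj; case: (v 0 j) => -[|[|]].
Qed.

Lemma holonomy_involution g : g \in Gamma -> linear_part g *m linear_part g = 1%:M.
Proof.
move=> gG; pose x := Subgroup gG.
have : hol (x * x)%g = hol 1%g.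
  by rewrite holM Z2_addvv -(Z2_addvv (hol 1%g)) -holM mulg1.
by move/hol_eq.
Qed.

Lemma holonomy_comm g h : g \in Gamma -> h \in Gamma ->
  comm_mx (linear_part g) (linear_part h).
Proof.
move=> gG hG; pose x := Subgroup gG; pose y := Subgroup hG.
have : hol (x * y)%g = hol (y * x)%g by rewrite !holM addrC.
by move/hol_eq.
Qed.

End Holonomy.

(** The linear parts form a finite set of commuting matrices with square 1.
    The eigenbasis need not be orthonormal: signs on the diagonal make the
    conjugated matrices orthogonal in any case. *)
Lemma holonomy_codiagonalizable (R : realType) (n : nat)
  (Gamma : groupClosed (rigid R n.+1)) : GHW Gamma ->
  exists2 P : 'M[R]_n.+1, P \in unitmx & forall g, g \in Gamma ->
    is_diag_mx (P *m linear_part g *m invmx P).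
Proof.
move=> [_ [F FM Fbij]].
pose As : seq 'M[R]_n.+1 :=
  [seq linear_part (\val (sval (cid (hol_surj Fbij v)))) | v <- enum 'rV['Z_2]_n].
have AsP g : g \in Gamma -> linear_part g \in As.
  move=> gG; apply/mapP; exists (hol F (Subgroup gG)); first by rewrite mem_enum.
  by case: cid => x /= /(hol_eq Fbij) /= ->.
have AsG A : A \in As -> exists2 g, g \in Gamma & A = linear_part g.
  by move=> /mapP[v _ ->]; eexists; last reflexivity; exact: valP.
have [P Pu /allP PAs] : codiagonalizable As.
  apply/codiagonalizableP; split.
    move=> A B /AsG[g gG ->] /AsG[h hG ->]; exact: holonomy_comm FM Fbij _ _ gG hG.
  move=> A /AsG[g gG ->]; apply: involution_diagonalizable.
  exact: holonomy_involution FM Fbij _ gG.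
by exists P => // g /AsP/PAs /=; rewrite -conjumx.
Qed.

Section Diagonalization.
Variables (R : realType) (n : nat) (Gamma : groupClosed (rigid R n.+1)).
Hypothesis ghwG : GHW Gamma.
Variable P : 'M[R]_n.+1.
Hypotheses (Pu : P \in unitmx)
  (Pd : forall g, g \in Gamma -> is_diag_mx (P *m linear_part g *m invmx P)).

(** The motion h is g written in the coordinates given by P. *)
Definition conjugates (g h : rigid R n.+1) : Prop :=
  [/\ g \in Gamma, diag_motion h, linear_part h *m P = P *m linear_part g &
      translation_part h = P *m translation_part g].

Lemma conjugates1 : conjugates 1%g 1%g.
Proof.
split; rewrite ?gpred1 ?diag_motion1 ?mulmx0//.
by rewrite /= mul1mx mulmx1.
Qed.

Lemma conjugatesM g h g' h' :
  conjugates g h -> conjugates g' h' -> conjugates (g * g')%g (h * h')%g.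
Proof.
move=> [gG dh lh th] [gG' dh' lh' th']; split; first by rewrite gpredM.
- exact: diag_motionM.
- by rewrite /= -mulmxA lh' !mulmxA lh.
- by rewrite /= th th' mulmxDr !mulmxA lh.
Qed.

Lemma conjugatesV g h : conjugates g h -> conjugates g^-1%g h^-1%g.
Proof.
move=> [gG dh lh th].
have lhT : (linear_part h)^T *m P = P *m (linear_part g)^T.
  rewrite -[LHS]mulmx1 -(rigid_linear_trmx g) mulmxA -[_ *m P *m _]mulmxA -lh.
  by rewrite !mulmxA (eqP (linear_part_orthogonal h)) mul1mx.
split; rewrite ?gpredV//; first exact: diag_motionV.
by rewrite /= th mulmxN !mulmxA lhT.
Qed.

Lemma conjugates_inj g g' h : conjugates g h -> conjugates g' h -> g = g'.
Proof.
move=> [_ _ lh th] [_ _ lh' th']; apply: rigid_pair_inj; congr (_, _).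
  by rewrite -[LHS](mulKmx Pu) -lh lh' mulKmx.
by rewrite -[LHS](mulKmx Pu) -th th' mulKmx.
Qed.

Lemma conjugates_fun g h h' : conjugates g h -> conjugates g h' -> h = h'.
Proof.
move=> [_ _ lh th] [_ _ lh' th']; apply: rigid_pair_inj; congr (_, _).
  by rewrite -[LHS](mulmxK Pu) lh -lh' mulmxK.
by rewrite th th'.
Qed.

Lemma conjugates_ex g : g \in Gamma -> exists h, conjugates g h.
Proof.
move=> gG; pose B := P *m linear_part g *m invmx P.
have [_ [F FM Fbij]] := ghwG.
have BB : B *m B = 1%:M.
  rewrite /B !mulmxA mulmxKV// -!mulmxA [linear_part g *m (_ *m _)]mulmxA.
  by rewrite (holonomy_involution FM Fbij gG) mul1mx mulmxV.
have dB : is_diag_mx B by exact: Pd.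
have BT : B^T *m B == 1%:M.
  by have /diag_mxP[d Bd] := dB; rewrite {1}Bd tr_diag_mx -Bd BB.
exists (Rigid (P *m translation_part g) BT); split=> //.
by rewrite /= /B mulmxKV.
Qed.

Definition diagonalized : rigid R n.+1 -> bool :=
  fun h => `[< exists g, conjugates g h >].

Lemma diagonalized_closed : group_closed diagonalized.
Proof.
split=> [|h h' /asboolP[g gh] /asboolP[g' gh']]; apply/asboolP.
  by exists 1%g; exact: conjugates1.
by exists (g * g'^-1)%g; apply: conjugatesM => //; exact: conjugatesV.
Qed.

Local Notation D := (pred_group diagonalized_closed).

Lemma diagonalized_iso :
  isomorphic (subgroup D) (subgroup Gamma).
Proof.
have ex (h : subgroup D) : exists g : subgroup Gamma, conjugates (\val g) (\val h).
  have /asboolP[g gh] := valP h; have [gD _ _ _] := gh.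
  by exists (Subgroup gD).
have [f fP] := choice ex.
have fM : {morph f : x y / (x * y)%g}.
  move=> x y; apply: val_inj; apply: conjugates_inj (fP _) _.
  exact: conjugatesM (fP x) (fP y).
exists (HB.pack_for {multiplicative _ -> _} f
  (isMultiplicative.Build _ _ f fM)).
have fsurj (g : subgroup Gamma) : exists h, f h = g.
  have [h gh] := conjugates_ex (valP g).
  have hD : h \in D by apply/asboolP; exists (\val g).
  exists (Subgroup hD); apply: val_inj.
  exact: conjugates_inj (fP (Subgroup hD)) gh.
have [f' f'K] := choice fsurj; exists f' => //= x.
apply: val_inj; apply: conjugates_fun (fP _) _.
by rewrite f'K; exact: fP.
Qed.

(** Such an element h has square 1. *)
Lemma diagonalized_free h : h \in D -> (forall i, sgn h i = 1 -> tr h i = 0) ->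
  h = 1%g.
Proof.
move=> /asboolP[g gh] free; have [gG dh _ _] := gh.
have hh : (h * h)%g = 1%g.
  apply: diag_motion_inj => [||i|i]; rewrite ?diag_motionM ?diag_motion1//.
    by rewrite sgn_mul// sgn_sqr// sgn1.
  rewrite tr_mul// tr1; have [hi|hi] := sgnP i dh; last by rewrite hi; ring.
  by rewrite free// mulr0 addr0.
have g1 : g = 1%g.
  have [[tf _ _] _] := ghwG; apply: (tf g 2) => //.
  rewrite expg2; apply: conjugates_inj conjugates1.
  by rewrite -hh; exact: conjugatesM.
by apply: conjugates_fun gh _; rewrite g1; exact: conjugates1.
Qed.

Lemma diagonalized_discrete : exists2 d : R, 0 < d & forall h, h \in D ->
  (forall i, sgn h i = 1) -> (forall i, `|tr h i| < d) -> h = 1%g.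
Proof.
have [[_ disc _] _] := ghwG; have [e e0 eG] := discrete_translations disc.
pose s := \sum_i \sum_j `|invmx P i j|.
have s0 : 0 <= s by apply: sumr_ge0 => i _; exact: sumr_ge0.
exists (e / (1 + s)); first by rewrite divr_gt0// ltr_pwDl.
move=> h /asboolP[g gh] hs ht; have [gG dh lh th] := gh.
suff g1 : g = 1%g by apply: conjugates_fun gh _; rewrite g1; exact: conjugates1.
apply: eG => // [|i].
  have h1 : linear_part h = 1%:M.
    rewrite (linear_diag_motion dh) -diag_const_mx; congr diag_mx.
    by apply/rowP => i; rewrite !mxE hs.
  by rewrite -[LHS](mulKmx Pu) -lh h1 mul1mx mulVmx.
have -> : tr g i = (invmx P *m translation_part h) i 0 by rewrite th mulKmx.
rewrite mxE; apply: le_lt_trans (ler_norm_sum _ _ _) _.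
apply: (@le_lt_trans _ _ (s * (e / (1 + s)))).
  have d0 : 0 <= e / (1 + s) by rewrite divr_ge0 ?ltW ?ltr_pwDl.
  apply: (@le_trans _ _ ((\sum_j `|invmx P i j|) * (e / (1 + s)))).
    rewrite mulr_suml; apply: ler_sum => j _; rewrite normrM ler_wpM2l//.
    exact/ltW/ht.
  rewrite ler_wpM2r// [leRHS](bigD1 i)//= lerDl; apply: sumr_ge0 => k _.
  exact: sumr_ge0.
rewrite mulrCA -[ltRHS]mulr1 ltr_pM2l// ltr_pdivrMr ?ltr_pwDl// mul1r.
by rewrite ltrDr.
Qed.

(** Otherwise all elements that preserve the orientation of the axis i act
    trivially on it, and all the others act by the same reflection.  The orbits
    of points with a large coordinate i then stay away from any given bounded
    set, against cocompactness. *)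
Lemma diagonalized_translation i : exists2 h, h \in D &
  (forall j, sgn h j = 1) /\ tr h i != 0.
Proof.
have [[_ _ /cocompact_bounded_orbit[C CG]] _] := ghwG.
apply: contrapT => none.
have dD h : h \in D -> diag_motion h by move=> /asboolP[g []].
have none2 h : h \in D -> sgn h i = 1 -> tr h i = 0.
  move=> hD hi; apply/eqP/negPn/negP => ti; apply: none.
  exists (h * h)%g; first by rewrite gpredM.
  split=> [j|]; first by rewrite sgn_mul ?dD// sgn_sqr ?dD.
  by rewrite tr_mul ?dD// hi mul1r -mulr2n mulrn_eq0 negb_or.
have [r rP] : exists r, forall h, h \in D -> sgn h i = - 1 -> tr h i = r.
  have [[h0 [h0D h0i]]|no] := pselect (exists h, h \in D /\ sgn h i = - 1).
    exists (tr h0 i) => h hD hi; apply/eqP; rewrite eq_sym -subr_eq0; apply/eqP.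
    rewrite -[RHS](none2 (h0 * h)%g) ?gpredM//.
      by rewrite tr_mul ?dD// h0i; ring.
    by rewrite sgn_mul ?dD// h0i hi mulrNN mulr1.
  by exists 0 => h hD hi; case: no; exists h.
(* In the new coordinates, the orbit of every point meets a set where the
   coordinate i is bounded by B; w is a point from which B is out of reach. *)
pose B := \sum_j `|P i j| * C.
pose w : 'cV[R]_n.+1 := const_mx (B + `|r| + 1).
have [g gG gC] := CG (invmx P *m w).
have [h gh] := conjugates_ex gG; have [_ dh lh th] := gh.
have hD : h \in D by apply/asboolP; exists g.
have hw : `|sgn h i * (B + `|r| + 1) + tr h i| <= B.
  have -> : sgn h i * (B + `|r| + 1) + tr h i =
      (P *m (linear_part g *m (invmx P *m w) + translation_part g)) i 0.
    rewrite mulmxDr !mulmxA -lh -th mulmxK// mxE; congr (_ + _).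
    by rewrite (linear_diag_motion dh) mul_diag_mx !mxE.
  rewrite mxE; apply: le_trans (ler_norm_sum _ _ _) _; apply: ler_sum => j _.
  by rewrite normrM ler_wpM2l.
have r0 : - `|r| <= r <= `|r| by rewrite -ler_norml.
case/andP: r0 => r0 r1.
have [hi|hi] := sgnP i dh.
  by move: hw; rewrite hi none2// ler_norml => /andP[_]; lra.
by move: hw; rewrite hi (rP h)// ler_norml => /andP[]; lra.
Qed.

(** The 2^n holonomies in dimension n + 1, multiplied by 1 and -1, yield
    pairwise distinct sign vectors because -1 is not a holonomy; there are
    2^(n+1) of them, so all sign vectors occur. *)
Lemma diagonalized_holonomy (s : 'I_n.+1 -> bool) : exists2 h, h \in D &
  exists b, forall i, sgn h i = (- 1) ^+ (s i (+) b).
Proof.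
have [_ [F FM Fbij]] := ghwG.
have ex (v : 'rV['Z_2]_n) : exists x : subgroup Gamma * rigid R n.+1,
    hol F x.1 = v /\ conjugates (\val x.1) x.2.
  have [x xv] := hol_surj Fbij v; have [h xh] := conjugates_ex (valP x).
  by exists (x, h).
have [e eP] := choice ex; pose h v := (e v).2.
have eC v : conjugates (\val (e v).1) (h v) by case: (eP v).
have hD v : h v \in D by apply/asboolP; exists (\val (e v).1).
have dh v : diag_motion (h v) by case: (eC v).
pose S (vb : 'rV['Z_2]_n * bool) : {ffun 'I_n.+1 -> bool} :=
  [ffun i => (sgn (h vb.1) i == - 1) (+) vb.2].
have sE v i : sgn (h v) i = (- 1) ^+ (sgn (h v) i == - 1).
  have [->|->] := sgnP i (dh v); last by rewrite eqxx expr1.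
  by rewrite (_ : (1 == - 1 :> R) = false)//; apply/negbTE/eqP/neq1N1.
have Sinj : injective S.
  move=> [v b] [v' b'] /ffunP SS.
  have prod i : sgn (h v * h v')%g i = (- 1) ^+ (b (+) b').
    rewrite sgn_mul// [sgn (h v) i]sE [sgn (h v') i]sE -signr_addb; congr (_ ^+ _).
    have := SS i; rewrite !ffunE /=.
    by clear SS; case: (_ == _) b (_ == _) b' => [] [] [] [].
  have bb : b = b'.
    apply/eqP/negPn/negP => bb.
    have bb1 : b (+) b' by rewrite addbC; case: b b' bb {SS prod} => [] [].
    have h1 : (h v * h v')%g = 1%g.
      apply: diagonalized_free => [|i]; first by rewrite gpredM ?hD.
      by rewrite prod bb1 expr1 => /esym/neq1N1.
    by have := prod ord0; rewrite h1 sgn1 bb1 expr1 => /neq1N1.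
  congr (_, _) => //.
  have [ve [gG _ lg _]] := eP v; have [ve' [gG' _ lg' _]] := eP v'.
  rewrite -[LHS]ve -[RHS]ve'; apply/(hol_eq Fbij).
  rewrite -[LHS](mulKmx Pu) -lg -[RHS](mulKmx Pu) -lg'; congr (_ *m (_ *m _)).
  rewrite (linear_diag_motion (dh v)) (linear_diag_motion (dh v')).
  congr diag_mx; apply/rowP => i; rewrite !mxE.
  have := prod i; rewrite bb addbb expr0 sgn_mul// => pr.
  by rewrite -/(h v) -[LHS]mulr1 -(sgn_sqr i (dh v')) mulrA pr mul1r.
have card : (#|{: {ffun 'I_n.+1 -> bool}}| <= #|{: 'rV['Z_2]_n * bool}|)%N.
  rewrite card_ffun card_prod card_mx !card_bool card_ord mul1n.
  by rewrite expnS mulnC card_ord.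
have /codomP[[v b] Svb] := inj_card_onto Sinj card [ffun i => s i].
exists (h v) => //; exists b => i; rewrite sE; congr (_ ^+ _).
have := congr1 (fun f : {ffun _ -> _} => f i) Svb; rewrite !ffunE /= => ->.
by rewrite -addbA addbb addbF.
Qed.

Lemma diagonalized_crystal : diagonal_crystal D.
Proof.
split.
- by move=> h /asboolP[g []].
- exact: diagonalized_free.
- exact: diagonalized_discrete.
- exact: diagonalized_translation.
- exact: diagonalized_holonomy.
Qed.

End Diagonalization.

Lemma GHW_crystal (R : realType) (n : nat) (Gamma : groupClosed (rigid R n.+1)) :
  GHW Gamma -> exists S : rigid R n.+1 -> bool, exists2 cS : group_closed S,
    diagonal_crystal (pred_group cS) &
    isomorphic (subgroup (pred_group cS)) (subgroup Gamma).
Proof.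
move=> ghwG; have [P Pu Pd] := holonomy_codiagonalizable ghwG.
exists (diagonalized Gamma P), (diagonalized_closed Gamma P).
  exact (diagonalized_crystal ghwG Pu Pd).
exact (diagonalized_iso ghwG Pu Pd).
Qed.

(** * The graph *)

Lemma monomorphic_trans (G H K : groupType) :
  monomorphic G H -> monomorphic H K -> monomorphic G K.
Proof.
move=> [f fi] [g gi]; pose h := g \o f.
have hM : {morph h : x y / (x * y)%g} by move=> x y; rewrite /h /= !gmulfM.
exists (HB.pack_for {multiplicative _ -> _} h
  (isMultiplicative.Build _ _ h hM)).
exact: inj_comp.
Qed.

Lemma isomorphic_monomorphic (G H : groupType) : isomorphic G H -> monomorphic G H.
Proof. by move=> [f /bij_inj fi]; exists f. Qed.

Lemma isomorphic_sym (G H : groupType) : isomorphic G H -> isomorphic H G.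
Proof.
move=> [f [g fK gK]].
have gM : {morph g : x y / (x * y)%g}.
  by move=> x y; apply: (can_inj fK); rewrite gmulfM !gK.
exists (HB.pack_for {multiplicative _ -> _} g
  (isMultiplicative.Build _ _ g gM)).
by exists f.
Qed.

Lemma isomorphic_trans (G H K : groupType) :
  isomorphic G H -> isomorphic H K -> isomorphic G K.
Proof.
move=> [f fi] [g gi]; pose h := g \o f.
have hM : {morph h : x y / (x * y)%g} by move=> x y; rewrite /h /= !gmulfM.
exists (HB.pack_for {multiplicative _ -> _} h
  (isMultiplicative.Build _ _ h hM)).
exact: bij_comp.
Qed.

Lemma klein_bottle_embeds (R : realType) (x : klein_bottle R) :
  monomorphic (fundamental_group R x) klein_deck.
Proof.
exists (HB.pack_for {multiplicative _ -> _} (@deck_of R x)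
  (isMultiplicative.Build _ _ (@deck_of R x) (@deck_ofM R x))).
exact: deck_of_inj.
Qed.

Lemma klein_subgroup (R : realType) (n : nat) (Gamma : groupClosed (rigid R n)) :
  (2 <= n)%N -> GHW Gamma -> monomorphic klein_deck (subgroup Gamma).
Proof.
case: n Gamma => // n Gamma n2 /GHW_crystal[S [cS dcS iso]].
apply: monomorphic_trans (klein_embeds dcS n2) _.
exact: isomorphic_monomorphic.
Qed.

Section Graph.
Variable R : realType.
Implicit Types G H : ghw R.

Lemma dim2_isomorphic G : ghw_dim G = 2 -> isomorphic (@ghw_group R G) klein_deck.
Proof.
case: G => n p cl n2 gh /= n2'; subst n; rewrite /ghw_group /=.
have [S [cS dcS iso]] := GHW_crystal gh.
apply/isomorphic_sym; apply: isomorphic_trans iso.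
exact: klein_surface.
Qed.

Lemma ghw_slice G : (2 < ghw_dim G)%N -> exists2 H, ghw_dim G = (@ghw_dim R H).+1 &
  monomorphic (@ghw_group R H) (@ghw_group R G).
Proof.
case: G => [[//|[//|n]] p cl n2 gh] /= n3.
have [S [cS dcS iso]] := GHW_crystal gh.
have [S' [cS' dcS' mono]] := crystal_slice (ltn0Sn n) dcS.
have n2' : (2 <= n.+1)%N by [].
exists (@Ghw R n.+1 S' cS' n2' (crystal_GHW dcS')) => //.
apply: monomorphic_trans mono _; exact: isomorphic_monomorphic.
Qed.

Lemma ghw_edge_sym : symmetric (@ghw_edge R).
Proof.
suff H v w : @ghw_edge R v w -> @ghw_edge R w v.
  by move=> v w; apply/idP/idP; exact: H.
move=> /asboolP[G [H [vG wH dim mono]]]; apply/asboolP; exists H, G.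
by split=> //; [case: dim; [right|left]|case: mono; [right|left]].
Qed.

Lemma path_to_dim2 G : exists2 H, ghw_dim H = 2 &
  exists2 p, path (@ghw_edge R) (\pi_(ghw_vertex R) G) p &
    last (\pi_(ghw_vertex R) G) p = \pi_(ghw_vertex R) H.
Proof.
have [k] := ubnP (@ghw_dim R G); elim: k G => // k IH G Gk.
have [G2|G3] := leqP (@ghw_dim R G) 2.
  exists G; last by exists [::].
  by apply/eqP; rewrite eqn_leq G2 ghw_dim_ge2.
have [H GH HG] := ghw_slice G3.
have [|K K2 [p pp pl]] := IH H; first by rewrite GH in Gk.
exists K => //; exists (\pi_(ghw_vertex R) H :: p) => //=.
rewrite pp andbT; apply/asboolP; exists G, H; split=> //; by right.
Qed.

Lemma ghw_graph_connected : graph_connected (@ghw_edge R).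
Proof.
move=> v w.
have [H H2 [p pp pl]] := path_to_dim2 (repr v).
have [K K2 [q qp ql]] := path_to_dim2 (repr w).
rewrite !reprK in pp pl qp ql.
have HK : \pi_(ghw_vertex R) H = \pi_(ghw_vertex R) K.
  apply/eqmodP/asboolP; apply: isomorphic_trans (dim2_isomorphic H2) _.
  exact/isomorphic_sym/dim2_isomorphic.
exists (p ++ rev (belast w q)).
  rewrite cat_path pp /= pl HK -ql rev_path.
  by rewrite (eq_path (e' := @ghw_edge R))// => x y; exact: ghw_edge_sym.
rewrite last_cat pl HK -ql.
case: q {qp} ql => [|a q] //= _; by rewrite rev_cons last_rcons.
Qed.

End Graph.

Theorem corollary8p1 (R : realType) :
  (forall (n : nat) (Gamma : groupClosed (rigid R n)) (x : klein_bottle R),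
     (2 <= n)%N -> GHW Gamma ->
     monomorphic (fundamental_group R x) (subgroup Gamma)) /\
  graph_connected (@ghw_edge R).
Proof.
split; last exact: ghw_graph_connected.
move=> n Gamma x n2 gh.
exact: monomorphic_trans (klein_bottle_embeds x) (klein_subgroup n2 gh).
Qed.
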